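(* Let $\mathcal A\subset\mathbb R^d$ be a point configuration. Every weight function $w:\mathcal A\to\mathbb R$ has a coherent decomposition $$w=w_0+\sum_{S^p\text{ a 1-split of }\mathcal A}\lambda_p w_p+\sum_{S\text{ a 2-split of }\mathcal A}\lambda_S w_S$$ with all $\lambda_p,\lambda_S\ge0$ and $w_0$ split prime, and this decomposition is unique among all coherent decompositions of $w$ into (nonnegative multiples of) the weight functions of $1$-splits and $2$-splits and a split prime weight function.
   Context: A point configuration is a finite multiset $\mathcal A\subset\mathbb R^d$ with affine hull $\mathbb R^d$. Subdivisions of $\mathcal A$: collections of subconfigurations closed under faces, whose convex hulls cover $\operatorname{conv}\mathcal A$ with pairwise disjoint relative interiors; $\Sigma'$ coarsens $\Sigma$ if each face of $\Sigma$ lies in a face of $\Sigma'$; coarsest = non-trivial and coarsened only by itself and the trivial subdivision (all faces of $\mathcal A$). For $w:\mathcal A\to\mathbb R$, $\Sigma_w(\mathcal A)$ is the regular subdivision given by the lower faces of $\operatorname{conv}\{(w(a),a)\}+\mathbb R_{\ge0}(1,0,\dots,0)$, and $\mathcal E_w(\mathcal A)=\{x\in\mathbb R\times\mathbb R^d:\langle(1,a),x\rangle\ge-w(a)\ \forall a\}$. A decomposition $w=\sum_i w_i$ is coherent if $\sum_i\mathcal E_{w_i}(\mathcal A)=\mathcal E_w(\mathcal A)$ (Minkowski sum). For an element $p\in\mathcal A$ with $p\in\operatorname{conv}(\mathcal A\setminus\{p\})$, the $1$-split $S^p$ is the subdivision with unique maximal face $\mathcal A\setminus\{p\}$, and $w_p$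 is the weight with $w_p(p)=1$ and $w_p=0$ on all other elements. A $2$-split is a coarsest subdivision with exactly two maximal faces; it is induced by a hyperplane $H_S=\{x:\langle\alpha,x\rangle=\beta\}$, and its weight function is $w_S(a)=|\langle\alpha,a\rangle-\beta|$. A weight function $w$ is split prime if $\Sigma_w(\mathcal A)$ does not refine any $1$-split or $2$-split of $\mathcal A$. *)

(* Defs.v *)
From HB Require Import structures.
From mathcomp Require Import all_boot all_order all_algebra.
From mathcomp Require Import all_classical all_reals topology normedtype.

Set Implicit Arguments.
Unset Strict Implicit.
Unset Printing Implicit Defensive.

Import Order.TTheory GRing.Theory Num.Theory.
Import numFieldNormedType.Exports.

Local Open Scope classical_set_scope.
Local Open Scope ring_scope.

Section Convexity.
Variables (R : realType) (n : nat).
Implicit Types (X Y : set 'rV[R]_n) (x y c : 'rV[R]_n).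

Definition dotv x y : R := \sum_k x 0 k * y 0 k.

Definition affine_hull X : set 'rV[R]_n :=
  [set x | exists (m : nat) (y : 'I_m -> 'rV[R]_n) (t : 'I_m -> R),
     [/\ forall k, X (y k), \sum_k t k = 1 & x = \sum_k t k *: y k]].

Definition convex_hull X : set 'rV[R]_n :=
  [set x | exists (m : nat) (y : 'I_m -> 'rV[R]_n) (t : 'I_m -> R),
     [/\ forall k, X (y k), forall k, 0 <= t k, \sum_k t k = 1
       & x = \sum_k t k *: y k]].

(* interior of X in the subspace topology of its affine hull *)
Definition relint X : set 'rV[R]_n :=
  [set x | X x /\ \forall y \near within (affine_hull X) (nbhs x), X y].

Definition minkowski_sum X Y : set 'rV[R]_n := [set x + y | x in X & y in Y].

End Convexity.

(* A point configuration (a finite multiset of points of R^d) is a family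
   a : I -> 'rV[R]_d indexed by a finite type I of labels, so that repeated
   points keep distinct labels; a subconfiguration is a set F : {set I} of
   labels, and a collection of subconfigurations is a {set {set I}}. *)
Section PointConfiguration.
Variables (R : realType) (d : nat) (I : finType) (a : I -> 'rV[R]_d).
Implicit Types (F G : {set I}) (S T : {set {set I}}) (p : I) (w v : I -> R).

Definition is_point_configuration : Prop := affine_hull (range a) = [set: 'rV[R]_d].

Definition conv F : set 'rV[R]_d := convex_hull (a @` [set` F]).

(* G consists of the points of F lying on a face of conv F.  As usual for
   polytopes, the empty set and F itself are faces of F. *)
Definition is_face F G : Prop :=
  exists (c : 'rV[R]_d) (g : R),
    (forall i, i \in F -> g <= dotv c (a i)) /\
    G = [set i in F | dotv c (a i) == g]%SET.

Definition faces F : {set {set I}} := [set G | `[< is_face F G >]]%SET.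

Definition is_subdivision S : Prop :=
  [/\ forall F G, F \in S -> is_face F G -> G \in S,
      \bigcup_(F in [set` S]) conv F = conv [set: I]%SET
    & forall F G, F \in S -> G \in S -> F != G ->
        relint (conv F) `&` relint (conv G) = set0].

(* T coarsens S, i.e. S refines T *)
Definition coarsens T S : Prop :=
  forall F, F \in S -> exists2 G, G \in T & F \subset G.

Definition trivial_subdivision : {set {set I}} := faces [set: I]%SET.

Definition is_coarsest S : Prop :=
  [/\ is_subdivision S, S <> trivial_subdivision
    & forall T, is_subdivision T -> coarsens T S ->
        T = S \/ T = trivial_subdivision].

Definition maximal_faces S : {set {set I}} :=
  [set F in S | [forall G in S, (F \subset G) ==> (G == F)]]%SET.

(* The ambient space R x R^d is 'rV[R]_(1 + d), with (r, x) = row_mx r%:M x. *)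

(* conv {(w(a), a)} + R_{>=0} (1, 0, ..., 0) *)
Definition lifted_polyhedron w : set 'rV[R]_(1 + d) :=
  minkowski_sum
    (convex_hull (range (fun i => row_mx (w i)%:M (a i))))
    [set row_mx r%:M 0 | r in [set r : R | 0 <= r]].

(* lower faces are those with an inner normal (c0, c) such that c0 > 0 *)
Definition is_lower_face (P Q : set 'rV[R]_(1 + d)) : Prop :=
  exists (c0 : R) (c : 'rV[R]_d) (g : R),
    [/\ 0 < c0,
        P `<=` [set z | g <= dotv (row_mx c0%:M c) z]
      & Q = P `&` [set z | dotv (row_mx c0%:M c) z = g]].

Definition regular_subdivision w : {set {set I}} :=
  [set F : {set I} | `[< exists Q, is_lower_face (lifted_polyhedron w) Q /\
     forall i, i \in F <-> Q (row_mx (w i)%:M (a i)) >]]%SET.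

Definition envelope w : set 'rV[R]_(1 + d) :=
  [set x | forall i, - w i <= dotv (row_mx 1%:M (a i)) x].

Definition is_coherent_decomposition w (vs : seq (I -> R)) : Prop :=
  (forall i, w i = \sum_(v <- vs) v i) /\
  \big[@minkowski_sum R (1 + d)/[set 0]]_(v <- vs) envelope v = envelope w.

Definition is_1split_point p : Prop := conv [set~ p]%SET (a p).

Definition split1 p : {set {set I}} := faces [set~ p]%SET.

Definition weight1 p : I -> R := fun i => (i == p)%:R.

Definition is_2split S : Prop := is_coarsest S /\ #|maximal_faces S| = 2%N.

(* the pair h = (alpha, beta) stands for the hyperplane
   {x | <alpha, x> = beta} *)
Definition induces_2split (h : 'rV[R]_d * R) S : Prop :=
  h.1 != 0 /\
  maximal_faces S = [set [set i | h.2 <= dotv h.1 (a i)];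
                         [set i | dotv h.1 (a i) <= h.2]]%SET.

(* The equation (alpha, beta) of H_S, hence also w_S, is determined by S only
   up to a scalar factor: h picks one such equation for each 2-split.  The
   existence premise makes this satisfiable for every configuration. *)
Definition is_equation_choice (h : {set {set I}} -> 'rV[R]_d * R) : Prop :=
  forall S, is_2split S ->
    (exists k, induces_2split k S) -> induces_2split (h S) S.

Definition weight2 (h : 'rV[R]_d * R) : I -> R :=
  fun i => `|dotv h.1 (a i) - h.2|.

Definition split_prime w : Prop :=
  (forall p, is_1split_point p -> ~ coarsens (split1 p) (regular_subdivision w)) /\
  (forall S, is_2split S -> ~ coarsens S (regular_subdivision w)).

Definition all_1splits : {set I} := [set p | `[< is_1split_point p >]]%SET.

Definition all_2splits : {set {set {set I}}} := [set S | `[< is_2split S >]]%SET.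

(* w = w0 + sum_p l1(p) w_p + sum_S l2(S) w_S, the sums running over all
   1-splits S^p and all 2-splits S *)
Definition is_split_decomposition (h : {set {set I}} -> 'rV[R]_d * R) w
    (w0 : I -> R) (l1 : I -> R) (l2 : {set {set I}} -> R) : Prop :=
  [/\ forall p, p \in all_1splits -> 0 <= l1 p,
      forall S, S \in all_2splits -> 0 <= l2 S,
      split_prime w0
    & is_coherent_decomposition w
        (w0 :: [seq (fun i => l1 p * weight1 p i) | p <- enum all_1splits]
            ++ [seq (fun i => l2 T * weight2 (h T) i) | T <- enum all_2splits])].

End PointConfiguration.

(* Main.v *)
(** A point x of the envelope of w is an affine function such that w + x is
    nonnegative on the configuration; the values of w + x are its slacks, and
    the cells of the regular subdivision are the zero sets of the slacks.  The
    gap of w at nonnegative weights c is the least c-weighted sum of the slacks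
    over the envelope.  It is subadditive in w and additive along coherent
    decompositions, so that coherence passes to partial sums.

    A split is given by its weight f and by the pairs (i, j) of labels that it
    separates, with i = j = p for the 1-split at p.  A weight w refines the
    split iff its gap at the test weights e_i / f(i) + e_j / f(j) is positive
    for all these pairs.  The smallest of these gaps, divided by that of f, is
    the largest multiple of f which can be subtracted coherently from w, and
    what remains no longer refines the split.  Doing this for one split after
    the other yields the decomposition.

    Conversely, the coefficient of a split s in any decomposition is this
    smallest gap of w, whence uniqueness: some cell of the split prime part
    crosses s, and this remains so when another split t is added coherently.
    Otherwise all segments of a full-dimensional cell that cross s would also
    cross t, and by first-order optimality of the gaps of t the hyperplanes of
    s and t would agree.

    That a 2-split is given by a hyperplane follows from Stiemke's lemma applied
    to its two maximal faces: the two sides of a separating hyperplane induce a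
    subdivision coarsening the split, hence equal to it. *)

Require Import Defs.
From mathcomp Require Import all_boot all_order all_algebra.
From mathcomp Require Import all_classical all_reals topology normedtype.
From mathcomp Require Import ring lra.

Set Implicit Arguments.
Unset Strict Implicit.
Unset Printing Implicit Defensive.

Import Order.TTheory GRing.Theory Num.Theory.
Import numFieldNormedType.Exports.

Local Open Scope classical_set_scope.
Local Open Scope ring_scope.

Local Notation homog y := (row_mx 1%:M y).
Local Notation nonneg c := (forall k, 0 <= c k).

(** * Linear inequalities *)

Section DotProduct.
Variables (R : realType) (n : nat).
Implicit Types x y z : 'rV[R]_n.

Lemma dotvC x y : dotv x y = dotv y x.
Proof. by apply: eq_bigr => k _; rewrite mulrC. Qed.

Lemma dotvDr x y z : dotv x (y + z) = dotv x y + dotv x z.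
Proof. by rewrite -big_split; apply: eq_bigr => k _; rewrite mxE mulrDr. Qed.

Lemma dotvZr x c y : dotv x (c *: y) = c * dotv x y.
Proof. by rewrite mulr_sumr; apply: eq_bigr => k _; rewrite mxE mulrCA. Qed.

Lemma dotv0r x : dotv x 0 = 0.
Proof. by rewrite -(scale0r 0) dotvZr mul0r. Qed.

Lemma dotvNr x y : dotv x (- y) = - dotv x y.
Proof. by rewrite -scaleN1r dotvZr mulN1r. Qed.

Lemma dotvDl x y z : dotv (x + y) z = dotv x z + dotv y z.
Proof. by rewrite dotvC dotvDr !(dotvC z). Qed.

Lemma dotvZl c x y : dotv (c *: x) y = c * dotv x y.
Proof. by rewrite dotvC dotvZr dotvC. Qed.

Lemma dotv0l x : dotv 0 x = 0.
Proof. by rewrite dotvC dotv0r. Qed.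

Lemma dotvNl x y : dotv (- x) y = - dotv x y.
Proof. by rewrite dotvC dotvNr dotvC. Qed.

Lemma dotv_suml (J : Type) (r : seq J) (P : pred J) (F : J -> 'rV[R]_n) x :
  dotv (\sum_(j <- r | P j) F j) x = \sum_(j <- r | P j) dotv (F j) x.
Proof.
by apply: (big_morph (fun y => dotv y x)) => [y z|]; rewrite ?dotvDl ?dotv0l.
Qed.

Lemma dotv_delta x k : dotv x (delta_mx 0 k) = x 0 k.
Proof.
rewrite /dotv (bigD1 k) //= mxE !eqxx mulr1 big1 ?addr0 // => j jk.
by rewrite mxE (negbTE jk) andbF mulr0.
Qed.

Lemma dotv_continuous x : continuous (dotv x).
Proof.
apply: (@continuous_big _ _ +%R 0 predT _ _ _ (fun k y => x 0 k * y 0 k)).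
  exact: add_continuous.
move=> k _ y.
exact: (continuousM (@cst_continuous _ _ _ y) (@coord_continuous _ _ _ 0 k y)).
Qed.

End DotProduct.

Lemma dotv_row_mx (R : realType) (m n : nat) (x1 y1 : 'rV[R]_m)
    (x2 y2 : 'rV[R]_n) :
  dotv (row_mx x1 x2) (row_mx y1 y2) = dotv x1 y1 + dotv x2 y2.
Proof.
rewrite /dotv big_split_ord /=; congr (_ + _); apply: eq_bigr => k _.
  by rewrite !row_mxEl.
by rewrite !row_mxEr.
Qed.

Lemma dotv_scalar (R : realType) (s t : R) : dotv s%:M t%:M = s * t.
Proof. by rewrite /dotv big_ord1 !mxE. Qed.

Lemma row_mx_scalarP (R : realType) (n : nat) (x : 'rV[R]_(1 + n)) :
  exists (s : R) (c : 'rV[R]_n), x = row_mx s%:M c.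
Proof.
exists (lsubmx x 0 0), (rsubmx x).
by rewrite -mx11_scalar hsubmxK.
Qed.

Section Farkas.
Variables (R : realType) (n : nat).
Implicit Types b x y : 'rV[R]_n.


(* Bartl's induction: when the first generator v i is needed, as witnessed by
   y, it is eliminated by projecting along it onto the orthogonal of y. *)
Lemma farkas_seq (J : eqType) (v : J -> 'rV[R]_n) b (r : seq J) : uniq r ->
    (forall x, (forall k, k \in r -> 0 <= dotv (v k) x) -> 0 <= dotv b x) ->
  exists2 t : J -> R, forall k, 0 <= t k & b = \sum_(k <- r) t k *: v k.
Proof.
elim: r v b => [|i r IHr] v b /= => [_ b_ge0|/andP[ir r_uniq] b_ge0].
  exists (fun=> 0) => //; rewrite big_nil; apply/rowP => k.
  rewrite mxE -dotv_delta.
  by apply/le_anti; rewrite -oppr_ge0 -dotvNr !b_ge0.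
have glue c t : 0 <= c -> (forall k, 0 <= t k) ->
    exists2 s : J -> R, forall k, 0 <= s k &
      c *: v i + \sum_(k <- r) t k *: v k = \sum_(k <- i :: r) s k *: v k.
  move=> c_ge0 t_ge0; exists (fun k => if k == i then c else t k).
    by move=> k; case: ifP.
  rewrite big_cons eqxx; congr (_ + _); apply: eq_big_seq => k kr.
  by case: eqP kr ir => // -> ->.
have [b_dual|] := pselect (forall x,
    (forall k, k \in r -> 0 <= dotv (v k) x) -> 0 <= dotv b x).
  have [t t_ge0 ->] := IHr v b r_uniq b_dual.
  have [s s_ge0 sE] := glue 0 t (lexx 0) t_ge0.
  by exists s; rewrite // -sE scale0r add0r.
move=> /existsNP[y /not_implyP[y_dual /negP]]; rewrite -ltNge => by_lt0.
have iy_lt0 : dotv (v i) y < 0.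
  rewrite ltNge; apply/negP => iy; move: by_lt0; rewrite ltNge b_ge0 // => k.
  by rewrite inE => /predU1P[->|/y_dual].
pose ratio c := dotv c y / dotv (v i) y.
pose proj c := c - ratio c *: v i.
have dotv_proj c x :
    dotv (proj c) x = dotv c (x - (dotv (v i) x / dotv (v i) y) *: y).
  by rewrite dotvDl dotvNl dotvZl dotvDr dotvNr dotvZr /ratio; ring.
have [x x_ge0|t t_ge0 bE] := IHr (fun k => proj (v k)) (proj b) r_uniq.
  rewrite dotv_proj b_ge0 // => k; rewrite inE => /predU1P[->|kr].
    by rewrite dotvDr dotvNr dotvZr divfK ?subrr // lt_eqF.
  by rewrite -dotv_proj x_ge0.
have [||s s_ge0 sE] := glue (ratio b - \sum_(k <- r) t k * ratio (v k)) t => //.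
  rewrite subr_ge0; apply: (@le_trans _ _ 0).
    rewrite big_seq sumr_le0 // => k kr; rewrite mulr_ge0_le0 //.
    by rewrite mulr_ge0_le0 ?y_dual // invr_le0 ltW.
  by rewrite mulr_le0 ?invr_le0 ?ltW.
exists s => //; rewrite -sE -[LHS](subrK (ratio b *: v i)) -/(proj b) bE.
under eq_bigr do rewrite scalerBr scalerA.
by rewrite sumrB -scaler_suml scalerBl addrC addrA addrAC.
Qed.

Lemma farkas (J : finType) (F : {set J}) (v : J -> 'rV[R]_n) b :
    (forall x, (forall k, k \in F -> 0 <= dotv (v k) x) -> 0 <= dotv b x) ->
  exists2 t : J -> R, forall k, 0 <= t k & b = \sum_(k in F) t k *: v k.
Proof.
move=> b_ge0.
have [x x_ge0|t t_ge0 bE] := @farkas_seq _ v b (enum F) (enum_uniq F).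
  by apply: b_ge0 => k kF; apply: x_ge0; rewrite mem_enum.
by exists t => //; rewrite bE big_enum.
Qed.

Lemma stiemke (J : finType) (F : {set J}) (v : J -> 'rV[R]_n) :
    (forall x, (forall k, k \in F -> 0 <= dotv (v k) x) ->
       forall k, k \in F -> dotv (v k) x = 0) ->
  exists2 t : J -> R, forall k, 0 < t k & \sum_(k in F) t k *: v k = 0.
Proof.
move=> F0.
have /choice[t tP] k : exists t : J -> R, k \in F ->
    (forall j, 0 <= t j) /\ - v k = \sum_(j in F) t j *: v j.
  have [kF|_] := boolP (k \in F); last by exists (fun=> 0).
  have [x xF|t] := @farkas _ F v (- v k); last by exists t.
  by rewrite dotvNl (F0 x xF k kF) oppr0.
exists (fun j => 1 + \sum_(k in F) t k j).
  by move=> j; rewrite ltr_wpDr // sumr_ge0 // => k /tP[].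
under eq_bigr do rewrite scalerDl scale1r scaler_suml.
rewrite big_split /= exchange_big /= -big_split /= big1 // => k /tP[_ <-].
by rewrite subrr.
Qed.

End Farkas.

Section LinearPrograms.
Variables (R : realType) (n : nat) (J : finType).
Variables (v : J -> 'rV[R]_n) (w : J -> R) (b : 'rV[R]_n).
Implicit Types (x y : 'rV[R]_n) (m : R).

Definition feasible x : Prop := forall k, 0 <= w k + dotv (v k) x.

(* Farkas' lemma for the system in the unknowns (s, x) obtained by homogenizing
   feasible x and dotv b x <= m: all its solutions satisfy s <= 0. *)
Lemma linear_program_margin m : feasible !=set0 ->
    ~ (exists2 x, feasible x & dotv b x <= m) ->
  exists2 e, 0 < e & forall x, feasible x -> m + e <= dotv b x.
Proof.
move=> [x0 x0_feasible] no_solution.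
pose constraint (j : option J) : 'rV[R]_(1 + n) :=
  if j is Some k then row_mx (w k)%:M (v k) else row_mx m%:M (- b).
have dotv_constraint j s x : dotv (constraint j) (row_mx s%:M x) =
    if j is Some k then w k * s + dotv (v k) x else m * s - dotv b x.
  by case: j => [k|] /=; rewrite dotv_row_mx dotv_scalar ?dotvNl.
have [X X_ge0|t t_ge0 tE] :=
    @farkas _ _ _ [set: option J]%SET constraint (row_mx (-1)%:M 0).
  have [s [x XE]] := row_mx_scalarP X.
  have constraint_ge0 j : 0 <= dotv (constraint j) (row_mx s%:M x).
    by rewrite -XE X_ge0.
  rewrite XE dotv_row_mx dotv_scalar dotv0l addr0 mulN1r oppr_ge0 leNgt.
  apply/negP => s_gt0; apply: no_solution; exists (s^-1 *: x) => [k|].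
    have -> : w k + dotv (v k) (s^-1 *: x) = s^-1 * (w k * s + dotv (v k) x).
      by rewrite dotvZr mulrDr mulrCA mulVf ?mulr1 // gt_eqF.
    have := constraint_ge0 (Some k).
    by rewrite dotv_constraint pmulr_rge0 ?invr_gt0.
  have := constraint_ge0 None; rewrite dotv_constraint subr_ge0 dotvZr.
  by rewrite mulrC ler_pdivrMl.
have margin x : feasible x -> 1 <= t None * (dotv b x - m).
  move=> x_feasible.
  have := congr1 (fun u => dotv u (row_mx 1%:M x)) tE.
  rewrite dotv_row_mx dotv_scalar dotv0l dotv_suml (big_setD1 None) ?inE //.
  rewrite dotvZl dotv_constraint; set others := \sum_(j in _) _ => /=.
  suff : 0 <= others by lra.
  apply: sumr_ge0 => -[k|]; last by rewrite !inE.
  by rewrite dotvZl dotv_constraint mulr1 mulr_ge0.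
have t_gt0 : 0 < t None.
  rewrite lt_def t_ge0 andbT; apply/eqP => t0.
  by have := margin _ x0_feasible; rewrite t0 mul0r ler10.
exists (t None)^-1 => [|x /margin]; first by rewrite invr_gt0.
by rewrite -ler_pdivrMl // mulr1 lerBrDl.
Qed.

Lemma linear_program_min : feasible !=set0 ->
    (exists m, forall x, feasible x -> m <= dotv b x) ->
  exists2 x, feasible x & forall y, feasible y -> dotv b x <= dotv b y.
Proof.
move=> [x0 x0_feasible] [m0 m0_le].
have values_inf : has_inf [set dotv b x | x in feasible].
  split; first by exists (dotv b x0), x0.
  by exists m0 => _ [x x_feasible <-]; exact: m0_le.
pose m := inf [set dotv b x | x in feasible].
have [[x x_feasible xm]|no_solution] :=
    pselect (exists2 x, feasible x & dotv b x <= m).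
  exists x => // y y_feasible; apply: le_trans xm _.
  by apply: ge_inf; [exact: values_inf.2|exists y].
have [|e e_gt0 margin] := @linear_program_margin m _ no_solution.
  by exists x0.
suff : m + e <= m by rewrite gerDl leNgt e_gt0.
by apply: lb_le_inf values_inf.1 _ => _ [x /margin ? <-].
Qed.

End LinearPrograms.

(** * Envelopes and gaps *)

Section AffineFunctions.
Variables (R : realType) (d : nat).
Implicit Types (x z : 'rV[R]_(1 + d)) (y : 'rV[R]_d).

(* The vector (s, c) of R x R^d stands for the affine function
   y |-> s + <c, y>. *)
Definition aff x y : R := dotv (homog y) x.

Lemma affD x z y : aff (x + z) y = aff x y + aff z y.
Proof. exact: dotvDr. Qed.

Lemma affZ c x y : aff (c *: x) y = c * aff x y.
Proof. exact: dotvZr. Qed.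

Lemma affN x y : aff (- x) y = - aff x y.
Proof. exact: dotvNr. Qed.

Lemma aff0 y : aff 0 y = 0.
Proof. exact: dotv0r. Qed.

Lemma aff_row (s : R) (c y : 'rV[R]_d) : aff (row_mx s%:M c) y = s + dotv c y.
Proof. by rewrite /aff dotv_row_mx dotv_scalar mul1r dotvC. Qed.

Lemma aff_line x y y' (r : R) :
  aff x (y + r *: (y' - y)) = (1 - r) * aff x y + r * aff x y'.
Proof.
have [s [c ->]] := row_mx_scalarP x.
by rewrite !aff_row dotvDr dotvZr dotvDr dotvNr; ring.
Qed.

Lemma aff_continuous x : continuous (aff x).
Proof.
have [s [c ->]] := row_mx_scalarP x.
rewrite (_ : aff _ = fun y => s + dotv c y).
  by move=> y; exact: cvgD (cvg_cst _) (@dotv_continuous _ _ c y).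
by apply/funext => y; rewrite aff_row.
Qed.

Lemma aff_eq0 x : (forall y, aff x y = 0) -> x = 0.
Proof.
have [s [c ->]] := row_mx_scalarP x => x0.
have s0 : s = 0 by rewrite -(x0 0) aff_row dotv0r addr0.
have -> : c = 0.
  apply/rowP => k; have := x0 (delta_mx 0 k).
  by rewrite aff_row s0 add0r dotv_delta mxE.
by rewrite s0 -scalemx1 scale0r row_mx0.
Qed.

Lemma sum_homog (J : finType) (P : pred J) (t : J -> R) (y : J -> 'rV[R]_d) :
  \sum_(k | P k) t k *: homog (y k) =
    row_mx (\sum_(k | P k) t k)%:M (\sum_(k | P k) t k *: y k).
Proof.
elim/big_rec3: _ => [|k s u v _ ->]; first by rewrite -scalemx1 scale0r row_mx0.
by rewrite scale_row_mx add_row_mx scale_scalar_mx mulr1 -raddfD.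
Qed.

End AffineFunctions.

Lemma exists_small_step (R : realType) (J : finType) (s e : J -> R) :
  exists2 r, 0 < r & forall k, 0 < s k -> 0 < s k + r * e k.
Proof.
have [[k0 sk0]|none] := pselect (exists k, 0 < s k); last first.
  by exists 1 => // k sk; case: none; exists k.
pose step k := s k / (1 + `|e k|).
have denom_gt0 k : 0 < 1 + `|e k| by rewrite ltr_wpDr.
have [k sk step_min] := @arg_minP _ _ _ k0 (fun k => 0 < s k) step sk0.
have step_gt0 : 0 < step k by rewrite divr_gt0.
exists (step k) => // i /step_min.
rewrite [leRHS]/step ler_pdivlMr // => step_le.
have : - `|step k * e i| <= step k * e i by rewrite lerNl ler_normr lexx orbT.
by rewrite normrM gtr0_norm //; lra.
Qed.

Lemma scale_realE (R : realType) (r s : R) : r *: s = r * s.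
Proof. by []. Qed.

Section Gap.
Variables (R : realType) (d : nat) (I : finType) (a : I -> 'rV[R]_d).
Implicit Types (w u v c s : I -> R) (x y z : 'rV[R]_(1 + d)) (k : I).

Definition slack w x k : R := w k + aff x (a k).

Definition cell w x : {set I} := [set k | slack w x k == 0]%SET.

Definition pairing c s : R := \sum_k c k * s k.

Lemma pairingDr c s1 s2 : pairing c (s1 + s2) = pairing c s1 + pairing c s2.
Proof.
by rewrite /pairing -big_split; apply: eq_bigr => k _; exact: mulrDr.
Qed.

Lemma pairingZr c (r : R) s : pairing c (r *: s) = r * pairing c s.
Proof. by rewrite /pairing mulr_sumr; apply: eq_bigr => k _; exact: mulrCA. Qed.

Lemma pairing_ge0 c s : nonneg c -> nonneg s -> 0 <= pairing c s.
Proof. by move=> c_ge0 s_ge0; apply: sumr_ge0 => k _; rewrite mulr_ge0. Qed.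

Lemma pairing_aff c x :
  pairing c (fun k => aff x (a k)) = dotv (\sum_k c k *: homog (a k)) x.
Proof. by rewrite dotv_suml; apply: eq_bigr => k _; rewrite dotvZl. Qed.

Lemma slackD u v x y : slack (u + v) (x + y) = slack u x + slack v y.
Proof. by apply/funext => k; rewrite /slack affD addrACA. Qed.

Lemma slackZ (r : R) w x : slack (r *: w) (r *: x) = r *: slack w x.
Proof.
by apply/funext => k; rewrite /slack affZ; exact: esym (mulrDr _ _ _).
Qed.

Lemma slack0 w : slack w 0 = w.
Proof. by apply/funext => k; rewrite /slack aff0 addr0. Qed.

Lemma pairing_slack c w x :
  pairing c (slack w x) = pairing c w + pairing c (fun k => aff x (a k)).
Proof. exact: pairingDr. Qed.

Lemma envelopeP w x : envelope a w x <-> nonneg (slack w x).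
Proof. by split=> wx k; have := wx k; rewrite /slack -lerBlDl sub0r. Qed.

Lemma envelope_neq0 w : envelope a w !=set0.
Proof.
exists (row_mx (\sum_k `|w k|)%:M 0); apply/envelopeP => k.
rewrite /slack aff_row dotv0l addr0 (bigD1 k) //= addrA addr_ge0 ?sumr_ge0 //.
by rewrite -lerBlDl sub0r -normrN ler_norm.
Qed.

Lemma envelope0 w : nonneg w -> envelope a w 0.
Proof. by move=> w_ge0; apply/envelopeP => k; rewrite slack0. Qed.

Lemma envelopeD u v x y :
  envelope a u x -> envelope a v y -> envelope a (u + v) (x + y).
Proof.
move=> /envelopeP ux /envelopeP vy; apply/envelopeP => k.
by rewrite slackD addr_ge0.
Qed.

Lemma envelopeZ (r : R) w x :
  0 <= r -> envelope a w x -> envelope a (r *: w) (r *: x).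
Proof.
move=> r_ge0 /envelopeP wx; apply/envelopeP => k.
by rewrite slackZ mulr_ge0.
Qed.

(* For convex weights c, the height of \sum_k c k *: (w k, a k) above the lower
   hull of the points (w k, a k). *)
Definition gap w c : R := inf [set pairing c (slack w x) | x in envelope a w].

Lemma le_gap w c (m : R) :
  (forall x, envelope a w x -> m <= pairing c (slack w x)) -> m <= gap w c.
Proof.
move=> m_le; apply: lb_le_inf => [|_ [x wx <-]]; last exact: m_le.
by have [x wx] := envelope_neq0 w; exists (pairing c (slack w x)), x.
Qed.

Section NonnegativeWeights.
Variable c : I -> R.
Hypothesis c_ge0 : nonneg c.

Lemma gap_ge0 w : 0 <= gap w c.
Proof. by apply: le_gap => x /envelopeP wx; exact: pairing_ge0. Qed.

Lemma gap_le w x : envelope a w x -> gap w c <= pairing c (slack w x).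
Proof.
move=> wx; apply: ge_inf; last by exists x.
by exists 0 => _ [y /envelopeP wy <-]; exact: pairing_ge0.
Qed.

Lemma gap_attained w :
  exists2 x, envelope a w x & pairing c (slack w x) = gap w c.
Proof.
pose b := \sum_k c k *: homog (a k).
have pairingE x : pairing c (slack w x) = pairing c w + dotv b x.
  by rewrite pairing_slack pairing_aff.
have [||x /envelopeP wx xmin] :=
    @linear_program_min _ _ _ (fun k => homog (a k)) w b.
- by have [x /envelopeP wx] := envelope_neq0 w; exists x.
- exists (gap w c - pairing c w) => x /envelopeP /gap_le.
  by rewrite pairingE lerBlDl.
exists x => //; apply/le_anti; rewrite gap_le // andbT.
by apply: le_gap => y /envelopeP /xmin; rewrite !pairingE lerD2l.
Qed.

Lemma gapD_le u v : gap (u + v) c <= gap u c + gap v c.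
Proof.
have [x ux <-] := gap_attained u; have [y vy <-] := gap_attained v.
by rewrite -pairingDr -slackD; apply/gap_le/envelopeD.
Qed.

Lemma gapZ (r : R) w : 0 <= r -> gap (r *: w) c = r * gap w c.
Proof.
have gapZ_le r' u : 0 <= r' -> gap (r' *: u) c <= r' * gap u c.
  move=> r'_ge0; have [x ux <-] := gap_attained u.
  by rewrite -pairingZr -slackZ; apply/gap_le/envelopeZ.
move=> r_ge0; apply/le_anti; rewrite gapZ_le //=.
have [->|r_neq0] := eqVneq r 0; first by rewrite mul0r gap_ge0.
rewrite -ler_pdivlMl ?lt_def ?r_neq0 //.
by rewrite -[X in gap X c](scalerK r_neq0) gapZ_le // invr_ge0.
Qed.

Lemma gap0 : gap 0 c = 0.
Proof. by rewrite -(scale0r 0) gapZ // mul0r. Qed.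

Lemma gap_sum_le (vs : seq (I -> R)) :
  gap (\sum_(v <- vs) v) c <= \sum_(v <- vs) gap v c.
Proof.
elim: vs => [|v vs IHvs]; first by rewrite !big_nil gap0.
by rewrite !big_cons (le_trans (gapD_le _ _)) // lerD2l.
Qed.

(* First-order optimality: from a minimizer x one can move slightly in the
   direction z without leaving the envelope. *)
Lemma gap_first_order w x z : envelope a w x ->
    pairing c (slack w x) = gap w c ->
    (forall k, slack w x k = 0 -> 0 <= aff z (a k)) ->
  0 <= pairing c (fun k => aff z (a k)).
Proof.
move=> /envelopeP wx xmin z_ge0.
have [r r_gt0 rP] := exists_small_step (slack w x) (fun k => aff z (a k)).
have slackE : slack w (x + r *: z) = slack w x + r *: (fun k => aff z (a k)).
  by apply/funext => k; rewrite /slack affD affZ addrA.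
have : envelope a w (x + r *: z).
  apply/envelopeP => k; rewrite slackE.
  have [wxk|/rP/ltW //] := leP (slack w x k) 0.
  have xk : slack w x k = 0 by apply/le_anti; rewrite wxk wx.
  by rewrite !fctE xk add0r mulr_ge0 ?z_ge0 // ltW.
move=> /gap_le; rewrite slackE pairingDr xmin lerDl pairingZr.
by rewrite pmulr_rge0.
Qed.

End NonnegativeWeights.
End Gap.

Section Vertices.
Variables (R : realType) (d : nat) (I : finType) (a : I -> 'rV[R]_d).
Hypothesis ha : is_point_configuration a.
Implicit Types (w : I -> R) (x y z : 'rV[R]_(1 + d)).

Lemma aff_config_eq0 z : (forall k, aff z (a k) = 0) -> z = 0.
Proof.
move=> z0; apply: aff_eq0 => y.
have : affine_hull (range a) y by rewrite ha.
case=> m [p [s [p_range s1 ->]]].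
rewrite /aff -[X in row_mx X%:M]s1 -sum_homog dotv_suml big1 // => j _.
by have [k _ <-] := p_range j; rewrite dotvZl -/(aff z (a k)) z0 mulr0.
Qed.

Lemma envelope_ray w x z k0 : envelope a w x ->
    (forall k, slack a w x k = 0 -> aff z (a k) = 0) -> aff z (a k0) < 0 ->
  exists r, envelope a w (x + r *: z) /\
    exists2 k, slack a w x k != 0 & slack a w (x + r *: z) k = 0.
Proof.
move=> /envelopeP x_ge0 z_tight zk0.
pose ratio k := slack a w x k / - aff z (a k).
have [k zk ratio_min] :=
  @arg_minP _ _ _ k0 (fun k => aff z (a k) < 0) ratio zk0.
have slackE i :
    slack a w (x + ratio k *: z) i = slack a w x i + ratio k * aff z (a i).
  by rewrite /slack affD affZ addrA.
exists (ratio k); split.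
  apply/envelopeP => i; rewrite slackE.
  have [zi|zi] := leP 0 (aff z (a i)).
    by rewrite addr_ge0 // mulr_ge0 // divr_ge0 // oppr_ge0 ltW.
  have := ratio_min i zi; rewrite [leRHS]/ratio ler_pdivlMr ?oppr_gt0 //; lra.
exists k; first by apply: contraTneq zk => /z_tight ->; rewrite ltxx.
by rewrite slackE /ratio invrN mulrN mulNr divfK ?subrr // lt_eqF.
Qed.

Definition is_vertex w x : Prop :=
  envelope a w x /\
  forall z, (forall k, slack a w x k = 0 -> aff z (a k) = 0) -> z = 0.

Lemma exists_vertex w x : envelope a w x ->
  exists2 y, is_vertex w y & cell a w x \subset cell a w y.
Proof.
move=> wx.
pose P F := `[< exists2 y, envelope a w y & F = cell a w y >].
have Px : P (cell a w x) by apply/asboolP; exists x.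
have [_ /maxsetP[/asboolP[y wy ->] cell_max] x_sub] := maxset_exists Px.
exists y => //; split=> // z z_tight.
apply: aff_config_eq0 => k0; apply/eqP; apply: contrapT => /negP zk0.
wlog zk0_lt0 : z z_tight zk0 / aff z (a k0) < 0.
  move=> wlog_neg; have [zk0_lt0|zk0_ge0] := ltP (aff z (a k0)) 0.
    exact: wlog_neg zk0_lt0.
  apply: (wlog_neg (- z)).
  - by move=> k /z_tight; rewrite affN => ->; rewrite oppr0.
  - by rewrite affN oppr_eq0.
  - by rewrite affN oppr_lt0 lt_def zk0.
have [r [wr [k yk rk]]] := envelope_ray wy z_tight zk0_lt0.
have /setP/(_ k) : cell a w (y + r *: z) = cell a w y.
  apply: cell_max; first by apply/asboolP; exists (y + r *: z).
  apply/fintype.subsetP => i; rewrite !inE => /eqP yi.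
  by rewrite /slack affD affZ addrA -/(slack a w y i) yi z_tight // mulr0 addr0.
by rewrite !inE rk eqxx (negbTE yk).
Qed.

End Vertices.

(** * Coherent decompositions into splits *)

Section CoherentDecompositions.
Variables (R : realType) (d : nat) (I : finType) (a : I -> 'rV[R]_d).
Implicit Types (w u v c : I -> R) (x y : 'rV[R]_(1 + d)) (vs : seq (I -> R)).

Lemma minkowski_sumA n : associative (@minkowski_sum R n).
Proof.
move=> X Y Z; apply/seteqP; split=> [_ [x Xx [_ [y Yy [z Zz <-]] <-]]|].
  by exists (x + y); [exists x => //; exists y|exists z; rewrite ?addrA].
move=> _ [_ [x Xx [y Yy <-]] [z Zz <-]].
by exists x => //; exists (y + z); [exists y => //; exists z|rewrite addrA].
Qed.

Lemma minkowski_sumx0 n : right_id [set 0] (@minkowski_sum R n).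
Proof.
move=> X; apply/seteqP; split=> [_ [x Xx [_ -> <-]]|x Xx].
  by rewrite addr0.
by exists x => //; exists 0; rewrite ?addr0.
Qed.

Lemma coherent_refl w : is_coherent_decomposition a w [:: w].
Proof. by split=> [i|]; rewrite big_cons big_nil ?addr0 ?minkowski_sumx0. Qed.

Lemma coherent_refine w u v vs :
    is_coherent_decomposition a w ((u + v) :: vs) ->
    (forall x, envelope a (u + v) x ->
       exists2 y, envelope a v y & envelope a u (x - y)) ->
  is_coherent_decomposition a w (u :: v :: vs).
Proof.
move=> [wE envE] splits; split=> [i|].
  by rewrite wE !big_cons addrA.
rewrite -envE !big_cons minkowski_sumA; congr (minkowski_sum _ _).
apply/seteqP; split=> [_ [x ux [y vy <-]]|x /splits[y vy uxy]].
  exact: envelopeD.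
by exists (x - y) => //; exists y; rewrite ?subrK.
Qed.

Lemma coherent_gap w vs c : is_coherent_decomposition a w vs ->
  nonneg c -> gap a w c = \sum_(v <- vs) gap a v c.
Proof.
move=> [wE envE] c_ge0.
have {}wE : w = \sum_(v <- vs) v by apply/funext => i; rewrite fct_sumE.
apply/le_anti; rewrite {1}wE gap_sum_le //=.
apply: le_gap => x; rewrite -envE wE.
elim: vs x {w wE envE} => [|v vs IHvs] x; rewrite !big_nil || rewrite !big_cons.
  by move=> ->; rewrite slack0 /pairing big1 // => k _; rewrite mulr0.
move=> [y vy [z /IHvs gap_z <-]].
by rewrite slackD pairingDr lerD // gap_le.
Qed.

Definition gap_additive vs :=
  forall c, nonneg c -> gap a (\sum_(v <- vs) v) c = \sum_(v <- vs) gap a v c.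

Lemma coherent_gap_additive w vs :
  is_coherent_decomposition a w vs -> gap_additive vs.
Proof.
move=> vs_coh c c_ge0; rewrite -(coherent_gap vs_coh c_ge0).
by congr (gap a _ c); apply/funext => i; rewrite fct_sumE; have [] := vs_coh.
Qed.

Lemma gap_additive_pairP u v : gap_additive [:: u; v] <->
  forall c, nonneg c -> gap a (u + v) c = gap a u c + gap a v c.
Proof.
by split=> additive c /additive; rewrite !big_cons !big_nil !addr0.
Qed.

(* Coherence passes to partial sums, by subadditivity of the gap. *)
Lemma gap_additive_cat vs1 vs2 : gap_additive (vs1 ++ vs2) ->
  [/\ gap_additive vs1, gap_additive vs2
    & gap_additive [:: \sum_(v <- vs1) v; \sum_(v <- vs2) v]].
Proof.
move=> vs_add.
have gaps c : nonneg c ->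
    [/\ gap a (\sum_(v <- vs1) v) c = \sum_(v <- vs1) gap a v c,
        gap a (\sum_(v <- vs2) v) c = \sum_(v <- vs2) gap a v c
      & gap a (\sum_(v <- vs1) v + \sum_(v <- vs2) v) c =
          gap a (\sum_(v <- vs1) v) c + gap a (\sum_(v <- vs2) v) c].
  move=> c_ge0; have := vs_add c c_ge0; rewrite !big_cat /=.
  have := gapD_le a c_ge0 (\sum_(v <- vs1) v) (\sum_(v <- vs2) v).
  have := gap_sum_le a c_ge0 vs1; have := gap_sum_le a c_ge0 vs2.
  by split; lra.
by split; try apply/gap_additive_pairP; move=> c /gaps[].
Qed.

End CoherentDecompositions.

Section Splits.
Variables (R : realType) (d : nat) (I : finType) (a : I -> 'rV[R]_d).
Implicit Types (w u f : I -> R) (x y : 'rV[R]_(1 + d)) (D : {set I * I}).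

(* On the pairs separated by a hyperplane, this is a multiple of the weights of
   the point where the segment from a ij.1 to a ij.2 crosses it. *)
Definition test_form f (ij : I * I) : I -> R :=
  fun k => ((k == ij.1)%:R / f ij.1 + (k == ij.2)%:R / f ij.2) / 2.

Lemma pairing_test f ij s :
  pairing (test_form f ij) s = (s ij.1 / f ij.1 + s ij.2 / f ij.2) / 2.
Proof.
have sum_delta i : \sum_k (k == i)%:R * s k = s i.
  rewrite (bigD1 i) //= eqxx mul1r big1 ?addr0 // => k /negbTE ->.
  by rewrite mul0r.
rewrite -(sum_delta ij.1) -(sum_delta ij.2) !mulr_suml -big_split mulr_suml.
by apply: eq_bigr => k _; rewrite /test_form /=; ring.
Qed.

(* D consists of the pairs of labels that do not lie in a common face of the
   split with weight f; for the 1-split at p, it is {(p, p)}. *)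
Record is_split f D : Prop := IsSplit {
  split_weight_ge0 : nonneg f;
  split_pairs_neq0 : D != finset.set0;
  split_pair_gt0 : forall ij, ij \in D -> 0 < f ij.1 /\ 0 < f ij.2;
  split_pairing_ge0 : forall x ij, envelope a f x -> ij \in D ->
    0 <= pairing (test_form f ij) (fun k => aff x (a k));
  split_subtract : forall u x (l : R), 0 <= l -> envelope a u x ->
    (forall ij, ij \in D -> l <= pairing (test_form f ij) (slack a u x)) ->
    exists2 y, envelope a (l *: f) y & envelope a (u - l *: f) (x - y) }.

(* Some cell of the regular subdivision of w contains a pair of D. *)
Definition crosses D w : Prop := exists x ij,
  [/\ envelope a w x, ij \in D, slack a w x ij.1 = 0 & slack a w x ij.2 = 0].

(* l *: f is then the largest multiple of f that can be subtracted coherently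
   from w. *)
Definition is_coherency_index f D w (l : R) : Prop :=
  (forall ij, ij \in D -> l <= gap a w (test_form f ij)) /\
  exists2 ij, ij \in D & gap a w (test_form f ij) = l.

Lemma coherency_index_uniq f D w (l l' : R) :
  is_coherency_index f D w l -> is_coherency_index f D w l' -> l = l'.
Proof.
move=> [l_le [ij ijD lE]] [l'_le [kl klD l'E]].
by apply/le_anti; rewrite -[X in l <= X]l'E l_le // -[X in l' <= X]lE l'_le.
Qed.

Lemma crosses_add_tight D u v x y ij :
    ij \in D -> envelope a u x -> envelope a v y ->
    slack a u x ij.1 = 0 -> slack a u x ij.2 = 0 ->
    slack a v y ij.1 = 0 -> slack a v y ij.2 = 0 ->
  crosses D (u + v).
Proof.
move=> ijD ux vy x1 x2 y1 y2; exists (x + y), ij; split=> //.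
- exact: envelopeD.
- by rewrite slackD fctE x1 y1 addr0.
- by rewrite slackD fctE x2 y2 addr0.
Qed.

Section OneSplit.
Variables (f : I -> R) (D : {set I * I}).
Hypothesis fD : is_split f D.

Lemma test_form_ge0 ij : ij \in D -> nonneg (test_form f ij).
Proof.
move=> /(split_pair_gt0 fD)[/ltW f1 /ltW f2] k.
by rewrite /test_form divr_ge0 // addr_ge0 // divr_ge0.
Qed.

Lemma pairing_test_weight ij : ij \in D -> pairing (test_form f ij) f = 1.
Proof.
move=> /(split_pair_gt0 fD)[f1 f2].
by rewrite pairing_test !divff ?gt_eqF //; lra.
Qed.

Lemma gap_split ij : ij \in D -> gap a f (test_form f ij) = 1.
Proof.
move=> ijD; apply/le_anti/andP; split.
  have := gap_le (test_form_ge0 ijD) (envelope0 a (split_weight_ge0 fD)).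
  by rewrite slack0 pairing_test_weight.
apply: le_gap => x fx; rewrite pairing_slack pairing_test_weight // lerDl.
exact: split_pairing_ge0 fD _ _ fx ijD.
Qed.

Lemma gap_test_eq0 w x ij : envelope a w x -> ij \in D ->
  slack a w x ij.1 = 0 -> slack a w x ij.2 = 0 -> gap a w (test_form f ij) = 0.
Proof.
move=> wx ijD x1 x2; have c_ge0 := test_form_ge0 ijD.
apply/le_anti; rewrite gap_ge0 // andbT (le_trans (gap_le c_ge0 wx)) //.
by rewrite pairing_test x1 x2 !mul0r addr0 mul0r.
Qed.

Lemma crossesP w :
  crosses D w <-> exists2 ij, ij \in D & gap a w (test_form f ij) = 0.
Proof.
split=> [[x [ij [wx ijD x1 x2]]]|[ij ijD gap_eq0]].
  by exists ij; rewrite // (gap_test_eq0 wx).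
have [x /[dup] wx /envelopeP x_ge0] := gap_attained a (test_form_ge0 ijD) w.
have [f1 f2] := split_pair_gt0 fD ijD.
rewrite gap_eq0 pairing_test => /eqP; rewrite mulf_eq0 invr_eq0 pnatr_eq0 orbF.
rewrite paddr_eq0 ?divr_ge0 ?(ltW f1) ?(ltW f2) // !mulf_eq0 !invr_eq0.
rewrite (gt_eqF f1) (gt_eqF f2) !orbF => /andP[/eqP x1 /eqP x2].
by exists x, ij.
Qed.

Lemma exists_coherency_index w :
  exists2 l, 0 <= l & is_coherency_index f D w l.
Proof.
have /set0Pn[ij0 ij0D] := split_pairs_neq0 fD.
have [ij ijD gap_min] :=
  @arg_minP _ _ _ ij0 (mem D) (fun ij => gap a w (test_form f ij)) ij0D.
exists (gap a w (test_form f ij)); first exact/gap_ge0/test_form_ge0.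
by split=> //; exists ij.
Qed.

Lemma coherency_index_subtract w (l : R) x : 0 <= l ->
    is_coherency_index f D w l -> envelope a w x ->
  exists2 y, envelope a (l *: f) y & envelope a (w - l *: f) (x - y).
Proof.
move=> l_ge0 [l_le _] wx; apply: (split_subtract fD) => // ij ijD.
by rewrite (le_trans (l_le _ ijD)) // gap_le //; exact: test_form_ge0.
Qed.

Lemma coherency_index_crosses w (l : R) : 0 <= l ->
    is_coherency_index f D w l -> gap_additive a [:: w - l *: f; l *: f] ->
  crosses D (w - l *: f).
Proof.
move=> l_ge0 [_ [ij ijD wE]] /gap_additive_pairP additive.
apply/crossesP; exists ij => //.
have c_ge0 := test_form_ge0 ijD; have := additive _ c_ge0.
rewrite subrK wE gapZ // gap_split // mulr1.
by move/eqP; rewrite -subr_eq subrr => /eqP <-.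
Qed.

Lemma split_first_order u (l : R) x z ij : 0 < l ->
    gap_additive a [:: u; l *: f] -> envelope a u x -> ij \in D ->
    slack a u x ij.1 = 0 -> slack a u x ij.2 = 0 ->
    (forall k, slack a u x k = 0 -> f k = 0 -> 0 <= aff z (a k)) ->
  0 <= aff z (a ij.1) / f ij.1 + aff z (a ij.2) / f ij.2.
Proof.
move=> l_gt0 /gap_additive_pairP additive ux ijD x1 x2 z_ge0.
have c_ge0 := test_form_ge0 ijD.
have gap_sum : gap a (u + l *: f) (test_form f ij) = l.
  rewrite additive // (gap_test_eq0 ux) // gapZ ?ltW // gap_split //.
  by rewrite mulr1 add0r.
have slackE : slack a (u + l *: f) x = slack a u x + l *: f.
  by apply/funext => k; exact: addrAC.
have lf_ge0 k : 0 <= l * f k.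
  by rewrite mulr_ge0 ?(ltW l_gt0) // (split_weight_ge0 fD).
have x_ge0 := (envelopeP _ _ _).1 ux.
suff : 0 <= pairing (test_form f ij) (fun k => aff z (a k)).
  by rewrite pairing_test pmulr_lge0 // invr_gt0 ltr0n.
apply: (gap_first_order c_ge0 (w := u + l *: f) (x := x)).
- by apply/envelopeP => k; rewrite slackE !fctE scale_realE addr_ge0.
- rewrite gap_sum slackE pairingDr pairingZr pairing_test_weight // mulr1.
  by rewrite pairing_test x1 x2 !mul0r addr0 mul0r add0r.
- move=> k /eqP; rewrite slackE !fctE scale_realE paddr_eq0 //.
  move=> /andP[/eqP xk].
  by rewrite mulf_eq0 (gt_eqF l_gt0) => /eqP; exact: z_ge0.
Qed.

End OneSplit.
End Splits.

Section SplitDecompositions.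
Variables (R : realType) (d : nat) (I : finType) (a : I -> 'rV[R]_d).
Variables (J : eqType) (f : J -> I -> R) (D : J -> {set I * I}).
Implicit Types (w u : I -> R) (l : J -> R) (r : seq J).

Lemma exists_coherent_decomposition w r : uniq r ->
    (forall j, j \in r -> is_split a (f j) (D j)) ->
  exists w0 l, [/\ forall j, j \in r -> 0 <= l j,
    is_coherent_decomposition a w (w0 :: [seq l j *: f j | j <- r])
    & forall j, j \in r -> crosses a (D j) w0].
Proof.
elim: r => [_ _|s r IHr /= /andP[sr r_uniq] splits].
  by exists w, (fun=> 0); split=> //; exact: coherent_refl.
have [|w1 [l [l_ge0 w1_coh w1_crosses]]] := IHr r_uniq.
  by move=> j jr; apply: splits; rewrite inE jr orbT.
have s_split : is_split a (f s) (D s) by exact/splits/mem_head.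
have [ls ls_ge0 ls_index] := exists_coherency_index s_split w1.
pose w0 := w1 - ls *: f s.
have w1E : w1 = w0 + ls *: f s by rewrite subrK.
have subtract x := coherency_index_subtract s_split ls_ge0 ls_index (x := x).
have w0_additive : gap_additive a [:: w0; ls *: f s].
  apply: (@coherent_gap_additive _ _ _ _ w1).
  by apply: coherent_refine; rewrite -w1E //; exact: coherent_refl.
pose l' j := if j == s then ls else l j.
have l'E j : j \in r -> l' j = l j.
  by rewrite /l'; case: eqP => // -> /(negP sr).
exists w0, l'; split=> [j||j].
- by rewrite inE /l'; case: eqP => //= _ /l_ge0.
- rewrite /= {1}/l' eqxx.
  rewrite (_ : [seq l' j *: f j | j <- r] = [seq l j *: f j | j <- r]).
    by apply: coherent_refine; rewrite -w1E.
  by apply/eq_in_map => j /l'E ->.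
- rewrite inE => /predU1P[->|jr].
    apply: (coherency_index_crosses s_split ls_ge0 ls_index).
    exact: w0_additive.
  have j_split : is_split a (f j) (D j) by apply: splits; rewrite inE jr orbT.
  have /(crossesP j_split)[ij ijD gap_eq0] := w1_crosses j jr.
  have c_ge0 := test_form_ge0 j_split ijD.
  apply/(crossesP j_split); exists ij => //.
  apply/le_anti; rewrite gap_ge0 // andbT -gap_eq0 w1E.
  by have /gap_additive_pairP -> // := w0_additive; rewrite lerDl gap_ge0.
Qed.

Variable r : seq J.
Hypothesis r_uniq : uniq r.
Hypothesis splits : forall j, j \in r -> is_split a (f j) (D j).
Hypothesis crosses_add : forall s t u (l : R),
  s \in r -> t \in r -> s != t -> 0 <= l ->
  gap_additive a [:: u; l *: f t] -> crosses a (D s) u ->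
  crosses a (D s) (u + l *: f t).

Lemma crosses_sum s u l r' : s \in r -> s \notin r' -> {subset r' <= r} ->
    (forall j, j \in r' -> 0 <= l j) ->
    gap_additive a (u :: [seq l j *: f j | j <- r']) -> crosses a (D s) u ->
  crosses a (D s) (u + \sum_(j <- r') l j *: f j).
Proof.
move=> sr; elim: r' u => [|t r' IHr'] u; first by rewrite big_nil addr0.
rewrite inE negb_or big_cons addrA => /andP[st sr'] sub l_ge0 additive.
move=> u_crosses; have [head_additive tail_additive sum_additive] :=
  @gap_additive_cat _ _ _ a [:: u; l t *: f t] _ additive.
apply: IHr' => //.
- by move=> j jr'; apply: sub; rewrite inE jr' orbT.
- by move=> j jr'; apply: l_ge0; rewrite inE jr' orbT.
- move=> c c_ge0; have := sum_additive c c_ge0.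
  by rewrite !big_cons !big_nil !addr0 tail_additive.
- by apply: crosses_add => //; [exact/sub/mem_head|exact/l_ge0/mem_head].
Qed.

Lemma coherent_coefficient w w0 l s : s \in r ->
    (forall j, j \in r -> 0 <= l j) ->
    is_coherent_decomposition a w (w0 :: [seq l j *: f j | j <- r]) ->
    crosses a (D s) w0 ->
  is_coherency_index a (f s) (D s) w (l s).
Proof.
move=> sr l_ge0 w_coh w0_crosses.
pose u := w0 + \sum_(j <- rem s r) l j *: f j.
have additive :
    gap_additive a (l s *: f s :: w0 :: [seq l j *: f j | j <- rem s r]).
  move=> c c_ge0; have := coherent_gap_additive w_coh c_ge0.
  by rewrite !big_cons !big_map !(big_rem s sr) /= addrCA [RHS]addrCA.
have [_ rest_additive] := @gap_additive_cat _ _ _ a [:: l s *: f s] _ additive.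
rewrite !big_cons big_nil addr0 big_map -/u => u_additive.
have wE : w = l s *: f s + u.
  apply/funext => i; have [-> _] := w_coh.
  by rewrite big_cons big_map (big_rem s sr) /= addrCA /u !fctE fct_sumE.
have gap_w c : nonneg c -> gap a w c = gap a (l s *: f s) c + gap a u c.
  by have /gap_additive_pairP/(_ c) := u_additive; rewrite -wE.
have s_split := splits sr.
have gap_s ij : ij \in D s ->
    gap a w (test_form (f s) ij) = l s + gap a u (test_form (f s) ij).
  move=> ijD; have c_ge0 := test_form_ge0 s_split ijD.
  by rewrite gap_w // gapZ ?l_ge0 // (gap_split s_split) ?mulr1.
have u_crosses : crosses a (D s) u.
  apply: crosses_sum => //; first by rewrite mem_rem_uniqF.
    by move=> j /mem_rem.
  by move=> j /mem_rem /l_ge0.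
split=> [ij ijD|]; last have /(crossesP s_split)[ij ijD gap_eq0] := u_crosses.
  by rewrite gap_s // lerDl gap_ge0 //; exact: test_form_ge0 s_split _ ijD.
by exists ij; rewrite // gap_s // gap_eq0 addr0.
Qed.

End SplitDecompositions.

(** * Convex hulls, faces and subdivisions *)

Section ConvexHulls.
Variables (R : realType) (d : nat) (I : finType) (a : I -> 'rV[R]_d).
Implicit Types (F G K : {set I}) (x y : 'rV[R]_d) (z : 'rV[R]_(1 + d)).
Implicit Types (k : I) (t : I -> R).

Lemma aff_comb F t y z : homog y = \sum_(k in F) t k *: homog (a k) ->
  aff z y = \sum_(k in F) t k * aff z (a k).
Proof.
by rewrite /aff => ->; rewrite dotv_suml; apply: eq_bigr => k _; rewrite dotvZl.
Qed.

Lemma convP F y : conv a F y <->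
  exists2 t, nonneg t & homog y = \sum_(k in F) t k *: homog (a k).
Proof.
split=> [[m [p [t [pF t_ge0 t1 ->]]]]|[t t_ge0]].
  have /choice[g gP] j : exists i, i \in F /\ a i = p j.
    by have [i iF <-] := pF j; exists i.
  exists (fun i => \sum_(j | g j == i) t j) => [i|]; first exact: sumr_ge0.
  rewrite -[X in row_mx X%:M _ = _]t1 -sum_homog.
  rewrite (partition_big g (mem F)) => [|j _]; last by have [] := gP j.
  apply: eq_bigr => i _; rewrite scaler_suml.
  by apply: eq_bigr => j /eqP <-; have [_ ->] := gP j.
rewrite sum_homog => /eq_row_mx[/matrixP/(_ 0 0)].
rewrite !mxE !eqxx !mulr1n => t1 ->.
exists #|F|, (fun j => a (enum_val j)), (fun j => t (enum_val j)); split=> //.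
- by move=> j; exists (enum_val j) => //; exact: enum_valP.
- by rewrite t1 [RHS]big_enum_val.
- by rewrite [LHS](big_enum_val (fun k => t k *: a k)).
Qed.

Lemma conv_affP F y : conv a F y <->
  forall z, (forall k, k \in F -> 0 <= aff z (a k)) -> 0 <= aff z y.
Proof.
split=> [/convP[t t_ge0 /aff_comb yE] z zF|y_ge0].
  by rewrite yE sumr_ge0 // => k kF; rewrite mulr_ge0 ?zF.
by apply/convP; exact: (@farkas _ _ _ F (fun k => homog (a k))).
Qed.

Lemma conv_sub F G y : F \subset G -> conv a F y -> conv a G y.
Proof.
move=> /fintype.subsetP FG /conv_affP yF; apply/conv_affP => z zG.
by apply: yF => k /FG /zG.
Qed.

Lemma conv_point F k : k \in F -> conv a F (a k).
Proof. by move=> kF; apply/conv_affP => z; exact. Qed.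

Lemma conv_segment F (r : R) x y : 0 <= r <= 1 -> conv a F x -> conv a F y ->
  conv a F (x + r *: (y - x)).
Proof.
move=> /andP[r_ge0 r_le1] /conv_affP xF /conv_affP yF; apply/conv_affP => z zF.
by rewrite aff_line addr_ge0 // mulr_ge0 ?xF ?yF ?subr_ge0.
Qed.

Lemma conv_aff_eq0 F y z :
    conv a F y -> (forall k, k \in F -> aff z (a k) = 0) ->
  aff z y = 0.
Proof.
move=> /conv_affP yF zF; apply/le_anti; rewrite -oppr_ge0 -affN !yF // => k kF.
  by rewrite zF.
by rewrite affN zF // oppr0.
Qed.

Definition face_of F z : {set I} := [set k in F | aff z (a k) == 0]%SET.

Lemma face_of_sub F z : face_of F z \subset F.
Proof. by apply/fintype.subsetP => k; rewrite inE => /andP[]. Qed.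

Lemma conv_face F y z :
    conv a F y -> (forall k, k \in F -> 0 <= aff z (a k)) -> aff z y = 0 ->
  conv a (face_of F z) y.
Proof.
move=> /convP[t t_ge0 yE] zF; rewrite (aff_comb z yE) => /eqP.
rewrite psumr_eq0 => [/allP ty0|k kF]; last by rewrite mulr_ge0 ?zF.
apply/convP; exists t => //; rewrite yE [in RHS]big_mkcond [in LHS]big_mkcond.
apply: eq_bigr => k _; rewrite inE; have [kF|//] := boolP (k \in F).
have := ty0 k (mem_index_enum _); rewrite kF mulf_eq0 /=.
by case: eqP => [->|_ /= ->] //; rewrite scale0r; case: ifP.
Qed.

Lemma affine_coordinates F : exists v : I -> 'rV[R]_(1 + d),
  forall y, affine_hull (conv a F) y ->
    homog y = \sum_(k in F) aff (v k) y *: homog (a k).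
Proof.
pose M : 'M[R]_(#|I|, 1 + d) :=
  \matrix_i (if enum_val i \in F then homog (a (enum_val i)) else 0).
have rowM k : k \in F -> row (enum_rank k) M = homog (a k).
  by move=> kF; rewrite rowK enum_rankK kF.
have convM y : conv a F y -> (homog y <= M)%MS.
  move=> /convP[t _ ->]; apply: summx_sub => k kF.
  by rewrite scalemx_sub // -rowM // row_sub.
exists (fun k => (col (enum_rank k) (pinvmx M))^T) => y [m [p [s [pF s1 yE]]]].
have yM : (homog y <= M)%MS.
  rewrite yE -s1 -sum_homog; apply: summx_sub => j _.
  by apply: scalemx_sub; exact: convM.
rewrite -{1}(mulmxKpV yM) mulmx_sum_row.
rewrite (reindex _ (onW_bij _ (enum_rank_bij I))) [RHS]big_mkcond /=.
apply: eq_bigr => k _; have [kF|/negbTE kF] := boolP (k \in F).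
  rewrite rowM // mxE; congr (_ *: _).
  by apply: eq_bigr => j _; rewrite !mxE.
by rewrite rowK enum_rankK kF scaler0.
Qed.

Lemma relint_positive_comb F t y : (forall k, k \in F -> 0 < t k) ->
    homog y = \sum_(k in F) t k *: homog (a k) ->
  relint (conv a F) y.
Proof.
move=> t_gt0 yE.
have comb_conv s x : (forall k, k \in F -> 0 <= s k) ->
    homog x = \sum_(k in F) s k *: homog (a k) -> conv a F x.
  move=> s_ge0 /aff_comb xE; apply/conv_affP => z zF.
  by rewrite xE sumr_ge0 // => k kF; rewrite mulr_ge0 ?s_ge0 ?zF.
have yF : conv a F y by apply: (comb_conv t) => // k /t_gt0/ltW.
split=> //; have [v vE] := affine_coordinates F.
have y_hull : affine_hull (conv a F) y.
  by exists 1%N, (fun=> y), (fun=> 1); split=> //; rewrite big_ord1 ?scale1r.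
pose close k x := k \in F -> `|aff (v k) y - aff (v k) x| < t k.
have : \forall x \near y, forall k, close k x.
  apply: (@filter_forall _ _ close _ (nbhs_filter y)) => k.
  have [/t_gt0 tk|kF] := boolP (k \in F).
    have v_cvg := @aff_continuous _ _ (v k) y.
    have := cvgr_dist_lt (FF := nbhs_filter y) _ _ v_cvg _ tk.
    by apply: filterS => x + _.
  by apply: nearW => x; rewrite /close (negbTE kF).
apply: filterS => x x_close x_hull.
apply: (comb_conv (fun k => t k + (aff (v k) x - aff (v k) y))).
  move=> k /x_close; rewrite ltr_norml => /andP[_]; lra.
under eq_bigr do rewrite scalerDl scalerBl.
by rewrite big_split sumrB -vE // -vE // -yE /= addrC subrK.
Qed.

Lemma relint_line (X : set 'rV[R]_d) x y : relint X x -> X y ->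
  \forall r \near (0 : R), X (x + r *: (y - x)).
Proof.
move=> [Xx X_near] Xy.
have line_cvg : (fun r : R => x + r *: (y - x)) @ 0 --> x.
  rewrite -[X in _ --> X]addr0 -(scale0r (y - x)).
  by apply: cvgD; [exact: cvg_cst|apply: cvgZr_tmp; exact: cvg_id].
have : \forall r \near (0 : R),
    affine_hull X (x + r *: (y - x)) -> X (x + r *: (y - x)).
  exact: (line_cvg _ X_near).
apply: filterS => r; apply.
exists 2, (fun i => if i == 0 then x else y).
exists (fun i => if i == 0 then 1 - r else r).
split=> [i||]; first by case: ifP.
  by rewrite !big_ord_recl big_ord0 /= addr0 subrK.
rewrite !big_ord_recl big_ord0 /= addr0 scalerBr scalerBl scale1r.
by rewrite addrA addrAC.
Qed.

Lemma relint_aff_eq0 F y z : relint (conv a F) y ->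
    (forall k, k \in F -> 0 <= aff z (a k)) -> aff z y = 0 ->
  forall k, k \in F -> aff z (a k) = 0.
Proof.
move=> Fy zF zy k kF.
have /nbhs_ballP[e e_gt0 segment] := relint_line Fy (conv_point kF).
have /conv_affP/(_ z zF) : conv a F (y + (- (e / 2)) *: (a k - y)).
  apply: segment; rewrite /ball /= sub0r opprK gtr0_norm ?divr_gt0 //.
  by rewrite ltr_pdivrMr // ltr_pMr // ltr1n.
rewrite aff_line zy mulr0 add0r mulNr oppr_ge0 pmulr_rle0 ?divr_gt0 //.
by move=> zk_le0; apply/le_anti; rewrite zk_le0 zF.
Qed.

Lemma relint_cone F t : F != finset.set0 -> (forall k, k \in F -> 0 < t k) ->
  relint (conv a F) ((\sum_(k in F) t k)^-1 *: \sum_(k in F) t k *: a k).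
Proof.
move=> /set0Pn[k0 k0F] t_gt0; set m := \sum_(k in F) t k.
have m_gt0 : 0 < m.
  rewrite /m (big_setD1 k0 k0F) ltr_pwDl ?t_gt0 // sumr_ge0 // => k.
  by move=> /setD1P[_ /t_gt0/ltW].
apply: (@relint_positive_comb _ (fun k => m^-1 * t k)) => [k kF|].
  by rewrite mulr_gt0 ?invr_gt0 ?t_gt0.
rewrite sum_homog -mulr_sumr mulVf ?gt_eqF //; congr row_mx.
by rewrite scaler_sumr; apply: eq_bigr => k _; rewrite scalerA.
Qed.

Lemma relint_neq0 F : F != finset.set0 -> relint (conv a F) !=set0.
Proof.
move=> F0; eexists; apply: (relint_cone (t := fun=> 1) F0) => k _.
exact: ltr01.
Qed.

Lemma separate_relint F G : F != finset.set0 -> G != finset.set0 ->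
    relint (conv a F) `&` relint (conv a G) = set0 ->
  exists z, [/\ forall k, k \in F -> 0 <= aff z (a k),
    forall k, k \in G -> 0 <= aff (- z) (a k)
    & exists2 k, k \in F :|: G & aff z (a k) != 0].
Proof.
move=> F0 G0 FG0; apply: contrapT => nsep.
pose A : {set I + I} :=
  [set j | match j with inl k => k \in F | inr k => k \in G end]%SET.
pose v (j : I + I) : 'rV[R]_(1 + d) :=
  match j with inl k => homog (a k) | inr k => - homog (a k) end.
have [z zA j jA|t t_gt0] := @stiemke _ _ _ A v.
  apply: contrapT => zj; apply: nsep; exists z; split.
  - by move=> k kF; apply: (zA (inl k)); rewrite inE.
  - by move=> k kG; rewrite affN -dotvNl; apply: (zA (inr k)); rewrite inE.
  - by case: j jA zj => k; rewrite inE /= ?dotvNl => kA /eqP zk; exists k;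
      rewrite ?inE ?kA ?orbT // -oppr_eq0.
rewrite big_mkcond big_sumType /=; under eq_bigr do rewrite inE.
under [X in _ + X]eq_bigr do rewrite inE.
rewrite -!big_mkcond /=; under [X in _ + X]eq_bigr do rewrite scalerN.
rewrite sumrN !sum_homog => /eqP; rewrite subr_eq0 => /eqP/eq_row_mx[].
move=> /matrixP/(_ 0 0); rewrite !mxE !eqxx !mulr1n => massE momentE.
have xF := relint_cone F0 (fun k _ => t_gt0 (inl k)).
have xG := relint_cone G0 (fun k _ => t_gt0 (inr k)).
rewrite -massE -momentE in xG.
have : (relint (conv a F) `&` relint (conv a G))
    ((\sum_(k in F) t (inl k))^-1 *: \sum_(k in F) t (inl k) *: a k) by split.
by rewrite FG0.
Qed.

End ConvexHulls.

Section Faces.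
Variables (R : realType) (d : nat) (I : finType) (a : I -> 'rV[R]_d).
Implicit Types (F G K : {set I}) (y : 'rV[R]_d) (x z : 'rV[R]_(1 + d)) (k : I).

Lemma is_faceP F G : is_face a F G <->
  exists2 z, forall k, k \in F -> 0 <= aff z (a k) & G = face_of a F z.
Proof.
split=> [[c [g [cF ->]]]|[z zF ->]].
  exists (row_mx (- g)%:M c) => [k kF|].
    by rewrite aff_row addrC subr_ge0 cF.
  by apply/setP => k; rewrite !inE aff_row addrC subr_eq0.
have [s [c zE]] := row_mx_scalarP z; rewrite {}zE in zF *.
exists c, (- s); split.
  by move=> k kF; rewrite -subr_ge0 opprK addrC -aff_row zF.
by apply/setP => k; rewrite !inE aff_row addrC -[in RHS]subr_eq0 opprK.
Qed.

Lemma face_refl F : is_face a F F.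
Proof.
apply/is_faceP; exists 0 => [k _|]; first by rewrite aff0.
by apply/setP => k; rewrite inE aff0 eqxx andbT.
Qed.

Lemma face_sub F G : is_face a F G -> G \subset F.
Proof. by move=> /is_faceP[z _ ->]; exact: face_of_sub. Qed.

Lemma face_of_perturb F z x : (forall k, k \in F -> 0 <= aff z (a k)) ->
    (forall k, k \in face_of a F z -> 0 <= aff x (a k)) ->
  exists2 r, (forall k, k \in F -> 0 <= aff (z + r *: x) (a k)) &
    face_of a F (z + r *: x) = face_of a (face_of a F z) x.
Proof.
move=> zF xG.
have [r r_gt0 rP] :=
  exists_small_step (fun k => aff z (a k)) (fun k => aff x (a k)).
have pos k : k \in F -> aff z (a k) != 0 -> 0 < aff (z + r *: x) (a k).
  by move=> kF zk; rewrite affD affZ rP // lt_def zk zF.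
exists r => [k kF|].
  have [zk|/(pos k kF)/ltW //] := eqVneq (aff z (a k)) 0.
  by rewrite affD affZ zk add0r mulr_ge0 ?xG ?inE ?kF ?zk ?eqxx // ltW.
apply/setP => k; rewrite !inE; have [kF|//] := boolP (k \in F).
have [zk|zk] := eqVneq (aff z (a k)) 0; last by rewrite (gt_eqF (pos k kF zk)).
by rewrite affD affZ zk add0r mulf_eq0 gt_eqF.
Qed.

Lemma face_trans F G K : is_face a F G -> is_face a G K -> is_face a F K.
Proof.
move=> /is_faceP[z zF ->] /is_faceP[x xG ->].
have [r rF rE] := face_of_perturb zF xG.
by apply/is_faceP; exists (z + r *: x).
Qed.

Lemma conv_neq0 F y : conv a F y -> F != finset.set0.
Proof.
move=> /conv_affP Fy; apply/eqP => F0.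
have : 0 <= aff (row_mx (-1)%:M 0) y by apply: Fy => k; rewrite F0 inE.
by rewrite aff_row dotv0l addr0 oppr_ge0 ler10.
Qed.

(* The smallest face containing y: there, no affine form vanishing at y is
   nonnegative without being zero, so that y is a positive combination. *)
Lemma conv_relint_face F y : conv a F y ->
  exists2 G, is_face a F G & relint (conv a G) y.
Proof.
move=> Fy.
pose P G := `[< exists z, [/\ forall k, k \in F -> 0 <= aff z (a k), aff z y = 0
  & G = face_of a F z] >].
have [|G /minsetP[/asboolP[z [zF yz GE]] Gmin]] := @ex_minset _ P.
  exists (face_of a F 0); apply/asboolP; exists 0.
  by split=> // [k _|]; rewrite aff0.
have [x xG k kG|t t_gt0 tE] :=
    @stiemke _ _ _ G (fun k => homog (a k) - homog y).
  pose x0 := x - row_mx (aff x y)%:M 0.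
  have x0E y' : aff x0 y' = dotv (homog y' - homog y) x.
    by rewrite affD affN aff_row dotv0l addr0 dotvDl dotvNl.
  have [j jG|r rF rE] := @face_of_perturb F z x0 zF.
    by rewrite x0E; apply: xG; rewrite GE.
  have : face_of a F (z + r *: x0) = G.
    apply: Gmin; last by rewrite rE -GE face_of_sub.
    apply/asboolP; exists (z + r *: x0); split=> //.
    by rewrite affD affZ yz x0E addrN dotv0l mulr0 addr0.
  by rewrite rE -GE => /setP/(_ k); rewrite kG inE x0E => /andP[_ /eqP].
have Gy : conv a G y by rewrite GE; apply: conv_face.
exists G; first by apply/is_faceP; exists z.
have m_neq0 : \sum_(k in G) t k != 0.
  have /set0Pn[k kG] := conv_neq0 Gy.
  rewrite gt_eqF // (big_setD1 k kG) ltr_pwDl // sumr_ge0 // => j _; exact: ltW.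
have -> : y = (\sum_(k in G) t k)^-1 *: \sum_(k in G) t k *: a k.
  apply: (scalerI m_neq0); rewrite scalerKV //.
  move: tE; under eq_bigr do rewrite scalerBr; rewrite sumrB !sum_homog => /eqP.
  by rewrite subr_eq0 => /eqP/eq_row_mx[_ ->]; rewrite scaler_suml.
by apply: relint_cone (conv_neq0 Gy) _ => k _.
Qed.

Lemma relint_face_sub F G K y : K \subset F -> is_face a F G ->
  relint (conv a K) y -> conv a G y -> K \subset G.
Proof.
move=> /fintype.subsetP KF /is_faceP[z zF ->] Ky Gy.
apply/fintype.subsetP => k kK.
rewrite inE KF //=; apply/eqP; apply: (relint_aff_eq0 Ky) kK.
  by move=> j /KF/zF.
by apply: (conv_aff_eq0 Gy) => j; rewrite inE => /andP[_ /eqP].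
Qed.

Definition side z : {set I} := [set k | 0 <= aff z (a k)]%SET.

Lemma relint_opposite_side F G z y : F \subset side z -> G \subset side (- z) ->
  relint (conv a F) y -> conv a G y -> F \subset side (- z).
Proof.
move=> /fintype.subsetP Fz /fintype.subsetP Gz Fy /conv_affP Gy.
have zF k : k \in F -> 0 <= aff z (a k) by move=> /Fz; rewrite inE.
have zy : aff z y = 0.
  apply/le_anti; have [/conv_affP/(_ z zF) -> _] := Fy; rewrite andbT.
  by rewrite -oppr_ge0 -affN Gy // => k /Gz; rewrite inE.
apply/fintype.subsetP => k kF.
by rewrite inE affN (relint_aff_eq0 Fy zF zy) ?oppr0.
Qed.

Definition covered_by_sides z : Prop :=
  conv a [set: I]%SET `<=` conv a (side z) `|` conv a (side (- z)).

Definition side_subdivision z : {set {set I}} :=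
  faces a (side z) :|: faces a (side (- z)).

Lemma in_side_subdivision z F :
  F \in side_subdivision z <-> is_face a (side z) F \/ is_face a (side (- z)) F.
Proof.
by rewrite !inE; split=> [/orP[]/asboolP|[]/asboolP ->]; rewrite ?orbT; auto.
Qed.

Lemma relint_side_subdivision_inj z F G y :
    F \in side_subdivision z -> G \in side_subdivision z ->
  relint (conv a F) y -> relint (conv a G) y -> F = G.
Proof.
move=> /in_side_subdivision FS /in_side_subdivision GS Fy Gy.
have same A B : is_face a A F -> is_face a B G ->
    F \subset B -> G \subset A -> F = G.
  move=> AF BG FB GA; apply/eqP; rewrite finset.eqEsubset.
  by rewrite (relint_face_sub FB BG Fy Gy.1) (relint_face_sub GA AF Gy Fy.1).
case: FS GS => Ff [] Gf; have Fs := face_sub Ff; have Gs := face_sub Gf.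
- exact: same Ff Gf Fs Gs.
- apply: same Ff Gf (relint_opposite_side Fs Gs Fy Gy.1) _.
  by rewrite -[z]opprK; apply: relint_opposite_side Gs _ Gy Fy.1; rewrite opprK.
- apply: same Ff Gf _ (relint_opposite_side Gs Fs Gy Fy.1).
  by rewrite -[z]opprK; apply: relint_opposite_side Fs _ Fy Gy.1; rewrite opprK.
- exact: same Ff Gf Fs Gs.
Qed.

Lemma is_subdivision_sides z :
  covered_by_sides z -> is_subdivision a (side_subdivision z).
Proof.
move=> cover; split=> [F G||F G FS GS /eqP FG].
- move=> /in_side_subdivision FS FG; apply/in_side_subdivision.
  by case: FS => FS; [left|right]; exact: face_trans FG.
- apply/seteqP; split=> [y [F /= _]|y /cover[yz|yz]].
  + exact: conv_sub (finset.subsetT _).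
  + exists (side z) => //=; apply/in_side_subdivision.
    by left; exact: face_refl.
  + exists (side (- z)) => //=; apply/in_side_subdivision.
    by right; exact: face_refl.
- apply/seteqP; split=> // y [Fy Gy]; apply: FG.
  exact: relint_side_subdivision_inj FS GS Fy Gy.
Qed.

End Faces.

Section MaximalFaces.
Variable I : finType.
Implicit Types (S : {set {set I}}) (F G K : {set I}).

Lemma maximal_facesP S F : F \in maximal_faces S <->
  F \in S /\ forall G, G \in S -> F \subset G -> G = F.
Proof.
rewrite inE; split=> [/andP[FS /forall_inP Fmax]|[FS Fmax]].
  by split=> // G /Fmax/implyP FG /FG/eqP.
rewrite FS; apply/forall_inP => G GS; apply/implyP => FG.
by rewrite (Fmax G GS FG).
Qed.

Lemma sub_maximal_face S K : K \in S ->
  exists2 F, F \in maximal_faces S & K \subset F.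
Proof.
move=> KS; have [F /maxsetP[FS Fmax] KF] := maxset_exists (P := mem S) KS.
exists F => //; apply/maximal_facesP; split=> // G GS FG; exact: Fmax.
Qed.

Definition is_maximal_pair S F G : Prop :=
  [/\ F \in S, G \in S, ~~ (F \subset G), ~~ (G \subset F)
    & forall K, K \in S -> K \subset F \/ K \subset G].

Lemma is_maximal_pair_sym S F G :
  is_maximal_pair S F G -> is_maximal_pair S G F.
Proof. by move=> [FS GS FG GF cover]; split=> // K /cover[]; auto. Qed.

Lemma is_maximal_pairP S F G :
  is_maximal_pair S F G <-> F != G /\ maximal_faces S = [set F; G]%SET.
Proof.
split=> [[FS GS FG GF cover]|[FG maxE]].
  split; first by apply: contraNneq FG => ->.
  apply/setP => K; apply/idP/idP => [/maximal_facesP[KS Kmax]|].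
    apply/set2P; have [/(Kmax F FS) ->|/(Kmax G GS) ->] := cover K KS; auto.
  case/set2P=> ->; apply/maximal_facesP; split=> // M MS sub; apply/eqP;
    rewrite finset.eqEsubset sub andbT; have [MF|MG] := cover M MS => //.
  - by move: FG; rewrite (fintype.subset_trans sub MG).
  - by move: GF; rewrite (fintype.subset_trans sub MF).
have /maximal_facesP[FS Fmax] : F \in maximal_faces S.
  by rewrite maxE set21.
have /maximal_facesP[GS Gmax] : G \in maximal_faces S.
  by rewrite maxE set22.
split=> // [||K /sub_maximal_face[M]].
- by apply: contra FG => /(Fmax G GS) ->.
- by apply: contra FG => /(Gmax F FS) ->.
- by rewrite maxE !inE => /orP[] /eqP ->; [left|right].
Qed.

Lemma maximal_faces_coarsens S T :
  maximal_faces S = maximal_faces T -> coarsens S T.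
Proof.
move=> ST F /sub_maximal_face[G]; rewrite -ST => /maximal_facesP[GS _] FG.
by exists G.
Qed.

End MaximalFaces.

Section TwoSplits.
Variables (R : realType) (d : nat) (I : finType) (a : I -> 'rV[R]_d).
Implicit Types (S T : {set {set I}}) (F G K : {set I}).
Implicit Types (y : 'rV[R]_d) (x z : 'rV[R]_(1 + d)) (i j k : I).

Lemma sub_side F z :
  F \subset side a z <-> forall k, k \in F -> 0 <= aff z (a k).
Proof.
split=> [/fintype.subsetP Fz k /Fz|Fz]; first by rewrite inE.
by apply/fintype.subsetP => k /Fz; rewrite inE.
Qed.

(* Points of conv A near the relative interior of conv G but off the hyperplane
   z = 0 are covered by conv F only, so conv F meets relint (conv G). *)
Lemma flat_face_sub S F G z i : is_subdivision a S -> F \in S -> G \in S ->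
    (forall K, K \in S -> K \subset F \/ K \subset G) -> G != finset.set0 ->
    (forall k, k \in G -> aff z (a k) = 0) -> 0 < aff z (a i) ->
  G \subset F.
Proof.
move=> [Sface Scov Srel] FS GS cover G0 zG zi.
have [b Gb] := relint_neq0 a G0; have [cGb _] := Gb.
have bz := conv_aff_eq0 cGb zG.
have Fb : conv a F b.
  apply/conv_affP => x xF; rewrite leNgt; apply/negP => bx.
  have [r r_gt0 rP] := exists_small_step
    (fun e : bool => if e then 1 else - aff x b)
    (fun e : bool => if e then -1 else aff x b - aff x (a i)).
  have r_lt1 : r < 1 by have /= := rP true ltr01; lra.
  have xy : aff x (b + r *: (a i - b)) < 0.
    have /= := rP false; rewrite oppr_gt0 => /(_ bx); rewrite aff_line; lra.
  have : conv a [set: I] (b + r *: (a i - b)).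
    apply: conv_segment; first by rewrite !ltW.
      exact: conv_sub (finset.subsetT G) cGb.
    exact: conv_point.
  rewrite -Scov => -[K /= /cover[] KX Ky]; have {}Ky := conv_sub KX Ky.
    by move/conv_affP/(_ x xF): Ky; rewrite leNgt xy.
  have /eqP := conv_aff_eq0 Ky zG; rewrite aff_line bz mulr0 add0r.
  by rewrite mulf_eq0 !gt_eqF.
have [F' FF' F'b] := conv_relint_face Fb.
have [->|GF'] := eqVneq G F'; first exact: face_sub FF'.
have : (relint (conv a G) `&` relint (conv a F')) b by [].
by rewrite Srel // (Sface F).
Qed.

Lemma strict_side_inhabited S F G z k :
    is_subdivision a S -> is_maximal_pair S F G ->
    F \subset side a z -> G \subset side a (- z) -> aff z (a k) != 0 ->
  exists i, 0 < aff z (a i).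
Proof.
move=> Ssub [FS GS FG _ cover] /sub_side zF /sub_side zG zk.
apply: contrapT => none.
have z_le0 i : aff z (a i) <= 0.
  by rewrite leNgt; apply/negP => zi; apply: none; exists i.
suff : F \subset G by rewrite (negbTE FG).
apply: (@flat_face_sub S G F (- z) k) => //.
- by move=> K /cover[]; auto.
- by apply: contraNneq FG => ->; exact: finset.sub0set.
- by move=> i iF; apply/eqP; rewrite affN oppr_eq0 eq_le z_le0 zF.
- by rewrite affN oppr_gt0 lt_neqAle zk z_le0.
Qed.

Lemma separate_maximal_pair S F G :
    is_subdivision a S -> is_maximal_pair S F G ->
  exists z, [/\ F \subset side a z, G \subset side a (- z),
    exists i, 0 < aff z (a i) & exists j, aff z (a j) < 0].
Proof.
move=> Ssub maxS; have [FS GS FG GF cover] := maxS; have [_ _ Srel] := Ssub.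
have F0 : F != finset.set0 by apply: contraNneq FG => ->; exact: finset.sub0set.
have G0 : G != finset.set0 by apply: contraNneq GF => ->; exact: finset.sub0set.
have F_neq_G : F != G by apply: contraNneq FG => ->.
have [z [/sub_side zF /sub_side zG [k _ zk]]] :=
  separate_relint F0 G0 (Srel F G FS GS F_neq_G).
exists z; split=> //; first exact: strict_side_inhabited Ssub maxS zF zG zk.
have [||j] := strict_side_inhabited Ssub (is_maximal_pair_sym maxS) (k := k) zG.
- by rewrite opprK.
- by rewrite affN oppr_eq0.
- by rewrite affN oppr_gt0; exists j.
Qed.

Lemma subdivision_covered_by_sides S z : is_subdivision a S ->
    (forall K, K \in S -> K \subset side a z \/ K \subset side a (- z)) ->
  covered_by_sides a z.
Proof.
move=> [_ Scov _] cover y; rewrite -Scov => -[K /= /cover[] Kz Ky].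
  by left; exact: conv_sub Kz Ky.
by right; exact: conv_sub Kz Ky.
Qed.

Lemma side_subdivision_maximal_pair z i j :
    0 < aff z (a i) -> aff z (a j) < 0 ->
  is_maximal_pair (side_subdivision a z) (side a z) (side a (- z)).
Proof.
move=> zi zj; split.
- by apply/in_side_subdivision; left; exact: face_refl.
- by apply/in_side_subdivision; right; exact: face_refl.
- apply/negP => /sub_side/(_ i); rewrite inE affN oppr_ge0 (ltW zi) leNgt zi.
  by move/(_ isT).
- apply/negP => /sub_side/(_ j); rewrite inE affN oppr_ge0 (ltW zj) leNgt zj.
  by move/(_ isT).
- by move=> K /in_side_subdivision[] /face_sub; [left|right].
Qed.

Lemma coarsest_side_subdivision S z i j : is_coarsest a S ->
    (forall K, K \in S -> K \subset side a z \/ K \subset side a (- z)) ->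
    0 < aff z (a i) -> aff z (a j) < 0 ->
  side_subdivision a z = S.
Proof.
move=> [Ssub _ Scoarsest] cover zi zj.
have [side_in oppo_in nsub _ sub_sides] := side_subdivision_maximal_pair zi zj.
have z_cover := subdivision_covered_by_sides Ssub cover.
have [|//|trivialE] := Scoarsest _ (is_subdivision_sides z_cover).
  by move=> K /cover[]; [exists (side a z)|exists (side a (- z))].
have : [set: I]%SET \in side_subdivision a z.
  by rewrite trivialE inE; apply/asboolP; exact: face_refl.
move=> /sub_sides[] /sub_side all_z.
  by have := all_z j (finset.in_setT j); rewrite leNgt zj.
by have := all_z i (finset.in_setT i); rewrite affN oppr_ge0 leNgt zi.
Qed.

Lemma exists_two_split_sides S : is_2split a S ->
  exists z, is_maximal_pair S (side a z) (side a (- z)).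
Proof.
move=> [Scoarsest /eqP/cards2P[F [G [FG maxE]]]]; have [Ssub _ _] := Scoarsest.
have /is_maximal_pairP maxS : F != G /\ maximal_faces S = [set F; G]%SET by [].
have [z [Fz Gz [i zi] [j zj]]] := separate_maximal_pair Ssub maxS.
exists z; rewrite -(coarsest_side_subdivision Scoarsest _ zi zj).
  exact: side_subdivision_maximal_pair zi zj.
have [_ _ _ _ cover] := maxS => K /cover[] KX.
  by left; exact: fintype.subset_trans KX Fz.
by right; exact: fintype.subset_trans KX Gz.
Qed.

Lemma two_split_maximal_faces_inj S T : is_2split a S -> is_2split a T ->
  maximal_faces S = maximal_faces T -> S = T.
Proof.
move=> [[Ssub Sntriv _] _] [[_ _ Tcoarsest] _] /maximal_faces_coarsens ST.
by have [|] := Tcoarsest S Ssub ST.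
Qed.

Lemma sides_scale (r : R) z : r != 0 ->
  [set side a (r *: z); side a (- (r *: z))]%SET =
  [set side a z; side a (- z)]%SET.
Proof.
have side_pos s z' : 0 < s -> side a (s *: z') = side a z'.
  by move=> s_gt0; apply/setP => k; rewrite !inE affZ pmulr_rge0.
have [r_gt0|r_lt0|//] := ltrgt0P r => _; first by rewrite -scalerN !side_pos.
rewrite finset.setUC -[r *: z]opprK -scaleNr opprK -scalerN.
by rewrite !side_pos ?oppr_gt0.
Qed.

Definition equation_vector (h : 'rV[R]_d * R) : 'rV[R]_(1 + d) :=
  row_mx (- h.2)%:M h.1.

Lemma weight2E h : weight2 a h = fun k => `|aff (equation_vector h) (a k)|.
Proof. by apply/funext => k; rewrite aff_row addrC. Qed.

Lemma induces_2splitP h S : induces_2split a h S <-> h.1 != 0 /\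
  maximal_faces S =
    [set side a (equation_vector h); side a (- equation_vector h)]%SET.
Proof.
have sideE : side a (equation_vector h) = [set i | h.2 <= dotv h.1 (a i)]%SET.
  by apply/setP => k; rewrite !inE aff_row addrC subr_ge0.
have oppE : side a (- equation_vector h) = [set i | dotv h.1 (a i) <= h.2]%SET.
  by apply/setP => k; rewrite !inE affN aff_row addrC oppr_ge0 subr_le0.
by rewrite sideE oppE.
Qed.

Lemma maximal_pair_strict_sides S z :
    is_maximal_pair S (side a z) (side a (- z)) ->
  (exists i, 0 < aff z (a i)) /\ (exists j, aff z (a j) < 0).
Proof.
move=> [_ _ /subsetPn[i _ zi] /subsetPn[j _ zj] _]; split.
  by exists i; rewrite ltNge -oppr_ge0 -affN; rewrite inE in zi.
by exists j; rewrite ltNge; rewrite inE in zj.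
Qed.

Lemma exists_two_split_equation S :
  is_2split a S -> exists h, induces_2split a h S.
Proof.
move=> /exists_two_split_sides[z maxS]; have [s [c zE]] := row_mx_scalarP z.
have [[i zi] [j zj]] := maximal_pair_strict_sides maxS.
have vecE : equation_vector (c, - s) = z by rewrite /equation_vector opprK zE.
exists (c, - s); apply/induces_2splitP; rewrite vecE; split; last first.
  by have [] := (is_maximal_pairP _ _ _).1 maxS.
apply/eqP => /= c0; move: zi zj.
by rewrite zE c0 !aff_row !dotv0l; lra.
Qed.

End TwoSplits.

(** * Point splits and hyperplane splits *)

Section ConcreteSplits.
Variables (R : realType) (d : nat) (I : finType) (a : I -> 'rV[R]_d).
Implicit Types (u : I -> R) (x z : 'rV[R]_(1 + d)) (i j k p q : I).
Implicit Types (D : {set I * I}).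

Lemma point_is_split p : is_1split_point a p ->
  is_split a (weight1 R p) [set (p, p)]%SET.
Proof.
move=> /conv_affP p_conv; split.
- by move=> k; rewrite ler0n.
- by apply/set0Pn; exists (p, p); rewrite inE.
- by move=> _ /set1P ->; rewrite /weight1 eqxx ltr01.
- move=> x _ /envelopeP x_ge0 /set1P ->.
  rewrite pairing_test /weight1 eqxx !divr1.
  have : 0 <= aff x (a p).
    apply: p_conv => k; rewrite !inE => /negbTE kp.
    by have := x_ge0 k; rewrite /slack /weight1 kp add0r.
  lra.
- move=> u x l l_ge0 /envelopeP x_ge0 /(_ (p, p)); rewrite inE eqxx => /(_ isT).
  rewrite pairing_test /weight1 eqxx !divr1 => /= l_le; exists 0.
    by apply: envelope0 => k; rewrite mulr_ge0 ?ler0n.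
  rewrite subr0; apply/envelopeP => k; have := x_ge0 k.
  rewrite /slack !fctE scale_realE /weight1.
  have [->|_] := eqVneq k p; last by rewrite mulr0 subr0.
  by move: l_le; rewrite /slack mulr1; lra.
Qed.

Definition hyperplane_weight z : I -> R := fun k => `|aff z (a k)|.

Definition separated_pairs z : {set I * I} :=
  [set ij | (0 < aff z (a ij.1)) && (aff z (a ij.2) < 0)]%SET.

Lemma separated_pairsP z i j :
  ((i, j) \in separated_pairs z) = (0 < aff z (a i)) && (aff z (a j) < 0).
Proof. by rewrite inE. Qed.

(* Up to a positive factor, this is the value of x at the point where the
   segment from a i to a j crosses the hyperplane z = 0; this point is a convex
   combination of points of the configuration on the hyperplane. *)
Lemma crossing_ge0 z x i j : covered_by_sides a z ->
    0 < aff z (a i) -> aff z (a j) < 0 ->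
    (forall k, aff z (a k) = 0 -> 0 <= aff x (a k)) ->
  0 <= aff x (a i) / aff z (a i) + aff x (a j) / - aff z (a j).
Proof.
move=> cover zi zj x_ge0.
pose m := aff z (a i) - aff z (a j).
have m_gt0 : 0 < m by rewrite subr_gt0 (lt_trans zj).
pose y := a i + (aff z (a i) / m) *: (a j - a i).
have affE x' : aff x' y = aff z (a i) * - aff z (a j) / m *
    (aff x' (a i) / aff z (a i) + aff x' (a j) / - aff z (a j)).
  rewrite aff_line /m; field.
  by rewrite (gt_eqF zi) (lt_eqF zj) (gt_eqF m_gt0).
have zy : aff z y = 0.
  by rewrite affE; field; rewrite (gt_eqF zi) (lt_eqF zj) (gt_eqF m_gt0).
suff : 0 <= aff x y.
  by rewrite affE pmulr_rge0 // divr_gt0 // mulr_gt0 ?oppr_gt0.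
have yA : conv a [set: I] y.
  apply: conv_segment; [|exact: conv_point..].
  rewrite divr_ge0 ?(ltW zi) ?(ltW m_gt0) //= ler_pdivrMr // mul1r.
  by rewrite lerDl oppr_ge0 ltW.
case: (cover _ yA) => yz.
- have : conv a (face_of a (side a z) z) y.
    by apply: conv_face => // k; rewrite inE.
  by move=> /conv_affP; apply => k; rewrite !inE => /andP[_ /eqP/x_ge0].
- have : conv a (face_of a (side a (- z)) (- z)) y.
    by apply: conv_face => // [k|]; rewrite ?inE // affN zy oppr0.
  move=> /conv_affP; apply => k; rewrite !inE affN oppr_eq0.
  by move=> /andP[_ /eqP/x_ge0].
Qed.

Lemma exists_hyperplane_multiple (s t : I -> R) (l : R) j0 :
    0 <= l -> nonneg s -> t j0 < 0 ->
    (forall i j, 0 < t i -> t j < 0 ->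
       l <= (s i / `|t i| + s j / `|t j|) / 2) ->
  exists c : R, forall k, 0 <= l * `|t k| + c * t k <= s k.
Proof.
move=> l_ge0 s_ge0 tj0 l_le; pose ratio k := s k / `|t k|.
have ratio_ge0 k : 0 <= ratio k by rewrite divr_ge0.
have sE k : t k != 0 -> s k = ratio k * `|t k|.
  by move=> tk; rewrite divfK // normr_eq0.
have [j tj ratio_min] := @arg_minP _ _ _ j0 (fun k => t k < 0) ratio tj0.
pose c : R := Num.max (- l) (l - ratio j); exists c => k.
have c_le : c <= l by rewrite ge_max; have := ratio_ge0 j; lra.
have c_geN : - l <= c by rewrite le_max lexx.
have c_ge : l - ratio j <= c by rewrite le_max lexx orbT.
have [tk|tk|->] := ltrgt0P (t k).
- have ratio_k := ratio_ge0 k; have ratio_kj := l_le k j tk tj.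
  rewrite -/(ratio k) -/(ratio j) in ratio_kj.
  have c_leB : c <= ratio k - l by rewrite ge_max; apply/andP; split; lra.
  rewrite sE ?gt_eqF // gtr0_norm // -mulrDl ler_pM2r //.
  by rewrite mulr_ge0 ?(ltW tk) //=; lra.
- have ratio_k := ratio_min k tk.
  rewrite sE ?lt_eqF // ltr0_norm // -[c * _]mulrNN -mulrDl.
  by rewrite ler_pM2r ?oppr_gt0 // mulr_ge0 ?oppr_ge0 ?(ltW tk) //=; lra.
- by rewrite !mulr0 addr0 lexx s_ge0.
Qed.

Lemma hyperplane_is_split z i0 j0 : covered_by_sides a z ->
    0 < aff z (a i0) -> aff z (a j0) < 0 ->
  is_split a (hyperplane_weight z) (separated_pairs z).
Proof.
move=> cover zi0 zj0; split.
- by move=> k; exact: normr_ge0.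
- by apply/set0Pn; exists (i0, j0); rewrite separated_pairsP zi0.
- move=> [i j]; rewrite separated_pairsP => /andP[zi zj] /=.
  by rewrite /hyperplane_weight !normr_gt0 gt_eqF // lt_eqF.
- move=> x [i j] /envelopeP x_ge0; rewrite separated_pairsP => /andP[zi zj].
  rewrite pairing_test /hyperplane_weight /= gtr0_norm // ltr0_norm //.
  rewrite divr_ge0 // crossing_ge0 // => k zk.
  by have := x_ge0 k; rewrite /slack /hyperplane_weight zk normr0 add0r.
- move=> u x l l_ge0 /envelopeP x_ge0 l_le.
  have [i j zi zj|c cP] := @exists_hyperplane_multiple (slack a u x)
      (fun k => aff z (a k)) l j0 l_ge0 x_ge0 zj0.
    have := l_le (i, j).
    by rewrite separated_pairsP zi zj pairing_test => /(_ isT).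
  exists (c *: z); apply/envelopeP => k; have /andP[c_ge c_le] := cP k.
    by rewrite /slack affZ.
  rewrite /slack affD affN affZ !fctE scale_realE /hyperplane_weight.
  by move: c_le; rewrite /slack; lra.
Qed.

End ConcreteSplits.

Section RegularSubdivisions.
Variables (R : realType) (d : nat) (I : finType) (a : I -> 'rV[R]_d).
Implicit Types (w : I -> R) (F G : {set I}) (S : {set {set I}}).
Implicit Types (z : 'rV[R]_(1 + d)) (p : I).

Lemma lifted_point w k : lifted_polyhedron a w (row_mx (w k)%:M (a k)).
Proof.
exists (row_mx (w k)%:M (a k)).
  exists 1%N, (fun=> row_mx (w k)%:M (a k)), (fun=> 1); split=> //.
  - by rewrite big_ord1.
  - by rewrite big_ord1 scale1r.
exists 0; last by rewrite addr0.
by exists 0; rewrite /= ?lexx // -scalemx1 scale0r row_mx0.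
Qed.

Lemma lifted_polyhedron_ge w (c : 'rV[R]_d) (g : R) :
    (forall k, g <= w k + dotv c (a k)) ->
  lifted_polyhedron a w `<=` [set z | g <= dotv (row_mx 1%:M c) z].
Proof.
move=> g_le _ [_ [m [p [t [p_range t_ge0 t1 ->]]]] [_ [r /= r_ge0 <-] <-]] /=.
rewrite dotvC dotvDl dotv_suml dotv_row_mx dotv_scalar dotv0l mulr1 addr0.
rewrite ler_wpDr // -[leLHS]mul1r -[X in X * _ <= _]t1 mulr_suml.
apply: ler_sum => k _.
rewrite dotvZl ler_wpM2l //; have [i _ <-] := p_range k.
by rewrite /= dotv_row_mx dotv_scalar mulr1 dotvC.
Qed.

Lemma in_regular_subdivision w F : F \in regular_subdivision a w <->
  exists2 z, envelope a w z & F = cell a w z.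
Proof.
rewrite inE; split=> [/asboolP[Q [[c0 [c [g [c0_gt0 g_le ->]]]] FQ]]|[z]].
  have c0_neq0 := lt0r_neq0 c0_gt0.
  pose z : 'rV[R]_(1 + d) := row_mx (- g / c0)%:M (c0^-1 *: c).
  have slackE k : slack a w z k =
      (dotv (row_mx c0%:M c) (row_mx (w k)%:M (a k)) - g) / c0.
    by rewrite /slack aff_row dotvZl dotv_row_mx dotv_scalar; field.
  exists z.
    apply/envelopeP => k; rewrite slackE divr_ge0 ?(ltW c0_gt0) // subr_ge0.
    exact/g_le/lifted_point.
  apply/setP => k; rewrite inE slackE mulf_eq0 invr_eq0 (negbTE c0_neq0).
  rewrite orbF subr_eq0.
  apply/idP/eqP => [/FQ[_ ->] //|gk].
  by apply/FQ; split=> //; exact: lifted_point.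
have [s [c ->]] := row_mx_scalarP z => /envelopeP z_ge0 ->.
have slackE k : slack a w (row_mx s%:M c) k =
    dotv (row_mx 1%:M c) (row_mx (w k)%:M (a k)) + s.
  by rewrite /slack aff_row dotv_row_mx dotv_scalar; ring.
apply/asboolP; eexists; split.
  exists 1, c, (- s); split=> //; apply: lifted_polyhedron_ge => k.
  by have := z_ge0 k; rewrite /slack aff_row; lra.
move=> i; rewrite inE slackE addr_eq0; split=> [/eqP E|[_ /= ->] //].
by split=> //; exact: lifted_point.
Qed.

Lemma not_coarsensP S (D : {set I * I}) w :
    (forall F, (exists2 G, G \in S & F \subset G) <->
       forall ij, ij \in D -> ~ (ij.1 \in F /\ ij.2 \in F)) ->
  ~ coarsens S (regular_subdivision a w) <-> crosses a D w.
Proof.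
move=> S_cells; split=> [not_coarsens|].
  apply: contrapT => not_crosses; apply: not_coarsens => F.
  move=> /in_regular_subdivision[x wx ->]; apply/S_cells => ij ijD.
  by rewrite !inE => -[/eqP x1 /eqP x2]; apply: not_crosses; exists x, ij.
move=> [x [ij [wx ijD /eqP x1 /eqP x2]]] S_coarsens.
have : exists2 G, G \in S & cell a w x \subset G.
  by apply: S_coarsens; apply/in_regular_subdivision; exists x.
by move/S_cells/(_ ij ijD); apply; rewrite !inE.
Qed.

Lemma not_coarsens_split1P p w :
  ~ coarsens (Defs.split1 a p) (regular_subdivision a w) <->
  crosses a [set (p, p)]%SET w.
Proof.
apply: not_coarsensP => F; split=> [[G] Gp FG _ /set1P -> /= [pF _]|F_no_pair].
  have : is_face a [set~ p]%SET G by move: Gp; rewrite inE => /asboolP.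
  move=> /face_sub/fintype.subsetP/(_ p (fintype.subsetP FG p pF)).
  by rewrite !inE eqxx.
exists [set~ p]%SET; first by rewrite inE; apply/asboolP; exact: face_refl.
apply/fintype.subsetP => k kF; rewrite !inE; apply/eqP => kp.
by apply: (F_no_pair (p, p)); rewrite ?inE //= -kp.
Qed.

Lemma not_coarsens_sidesP S z w : is_maximal_pair S (side a z) (side a (- z)) ->
  ~ coarsens S (regular_subdivision a w) <-> crosses a (separated_pairs a z) w.
Proof.
move=> [side_in oppo_in _ _ S_sides]; apply: not_coarsensP => F; split.
  move=> [G /S_sides Gz FG] [i j]; rewrite separated_pairsP => /andP[zi zj].
  move=> [/= iF jF].
  case: Gz => /(fintype.subset_trans FG)/sub_side Fz.
    by have := Fz j jF; rewrite leNgt zj.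
  by have := Fz i iF; rewrite affN oppr_ge0 leNgt zi.
move=> F_no_pair.
have [[j jF zj]|none] := pselect (exists2 j, j \in F & aff z (a j) < 0).
  exists (side a (- z)) => //; apply/sub_side => i iF.
  rewrite affN oppr_ge0 leNgt; apply/negP => zi.
  apply: (F_no_pair (i, j)) => //.
  by rewrite separated_pairsP zi zj.
exists (side a z) => //; apply/sub_side => k kF; rewrite leNgt.
by apply/negP => zk; apply: none; exists k.
Qed.

End RegularSubdivisions.

Section AddingSplits.
Variables (R : realType) (d : nat) (I : finType) (a : I -> 'rV[R]_d).
Implicit Types (u : I -> R) (x z g : 'rV[R]_(1 + d)) (i j k p q : I) (l : R).
Implicit Types (D : {set I * I}).

Lemma hyperplane_weightN z : hyperplane_weight a (- z) = hyperplane_weight a z.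
Proof. by apply/funext => k; rewrite /hyperplane_weight affN normrN. Qed.

Lemma envelope_hyperplane z l :
  0 <= l -> envelope a (l *: hyperplane_weight a z) (l *: - z).
Proof.
move=> l_ge0; apply: envelopeZ => //; apply/envelopeP => k.
by rewrite /slack affN subr_ge0 ler_norm.
Qed.

Lemma slack_hyperplane z l k : 0 <= aff z (a k) ->
  slack a (l *: hyperplane_weight a z) (l *: - z) k = 0.
Proof.
move=> zk; rewrite slackZ !fctE /slack affN /hyperplane_weight ger0_norm //.
by rewrite subrr scaler0.
Qed.

Lemma crosses_add_hyperplane D u z l x ij : 0 <= l -> ij \in D ->
    envelope a u x -> slack a u x ij.1 = 0 -> slack a u x ij.2 = 0 ->
    0 <= aff z (a ij.1) * aff z (a ij.2) ->
  crosses a D (u + l *: hyperplane_weight a z).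
Proof.
move=> l_ge0 ijD ux x1 x2.
have same_side z' : 0 <= aff z' (a ij.1) -> 0 <= aff z' (a ij.2) ->
    crosses a D (u + l *: hyperplane_weight a z').
  move=> z1 z2; have z_env := envelope_hyperplane z' l_ge0.
  by apply: (crosses_add_tight ijD ux z_env) => //; exact: slack_hyperplane.
have [z1|z1|z1] := ltrgt0P (aff z (a ij.1)).
- by rewrite pmulr_rge0 // => z2; apply: same_side => //; exact: ltW.
- rewrite nmulr_rge0 // => z2; rewrite -hyperplane_weightN.
  by apply: same_side; rewrite affN oppr_ge0 // ltW.
- have [z2 _|/ltW z2 _] := leP 0 (aff z (a ij.2)).
    by apply: same_side; rewrite ?z1.
  by rewrite -hyperplane_weightN; apply: same_side; rewrite affN ?z1 oppr_ge0.
Qed.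

Lemma crosses_add_point D u q l x ij : 0 <= l -> ij \in D ->
    envelope a u x -> slack a u x ij.1 = 0 -> slack a u x ij.2 = 0 ->
    ij.1 != q -> ij.2 != q ->
  crosses a D (u + l *: weight1 R q).
Proof.
move=> l_ge0 ijD ux x1 x2 ij1 ij2.
have w_env : envelope a (l *: weight1 R q) 0.
  by apply: envelope0 => k; rewrite mulr_ge0 ?ler0n.
apply: (crosses_add_tight ijD ux w_env) => //; rewrite slack0 !fctE /weight1.
  by rewrite (negbTE ij1) scaler0.
by rewrite (negbTE ij2) scaler0.
Qed.

(* Otherwise moving x in the direction - z would lower the value at q. *)
Lemma tight_beside_point u q l x z : is_1split_point a q -> 0 < l ->
    gap_additive a [:: u; l *: weight1 R q] -> envelope a u x ->
    slack a u x q = 0 -> 0 < aff z (a q) ->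
  exists k, [/\ k != q, slack a u x k = 0 & 0 < aff z (a k)].
Proof.
move=> q_split l_gt0 additive ux xq zq; apply: contrapT => none.
have := split_first_order (point_is_split q_split) (z := - z) (ij := (q, q))
  l_gt0 additive ux.
rewrite inE eqxx => /(_ isT xq xq) /=.
rewrite /weight1 eqxx affN !divr1 => zq_le0.
suff : 0 <= - aff z (a q) + - aff z (a q) by lra.
apply: zq_le0 => k xk /eqP; rewrite pnatr_eq0 eqb0 => kq.
by rewrite affN oppr_ge0 leNgt; apply/negP => zk; apply: none; exists k.
Qed.

Lemma crosses_hyperplane_add_point u q z l : is_1split_point a q -> 0 < l ->
    gap_additive a [:: u; l *: weight1 R q] ->
    crosses a (separated_pairs a z) u ->
  crosses a (separated_pairs a z) (u + l *: weight1 R q).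
Proof.
move=> q_split l_gt0 additive [x [[i j] [ux]]].
rewrite separated_pairsP => /andP[zi zj] /= xi xj.
have beside k z' : slack a u x k = 0 -> 0 < aff z' (a k) ->
    exists k', [/\ k' != q, slack a u x k' = 0 & 0 < aff z' (a k')].
  have [->|kq] := eqVneq k q; first exact: tight_beside_point additive ux.
  by exists k.
have [i' [i'q xi' zi']] := beside i z xi zi.
have [|j' [j'q xj']] := beside j (- z) xj; first by rewrite affN oppr_gt0.
rewrite affN oppr_gt0 => zj'.
have ij'D : (i', j') \in separated_pairs a z.
  by rewrite separated_pairsP zi' zj'.
exact: crosses_add_point (ltW l_gt0) ij'D ux xi' xj' i'q j'q.
Qed.

Lemma collinear_of_separation (K : I -> Prop) (s t : I -> R) i0 j0 :
    K i0 -> K j0 -> 0 < s i0 -> s j0 < 0 ->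
    (forall i j, K i -> K j -> 0 < s i -> s j < 0 -> t i * t j < 0) ->
    (forall i j, K i -> K j -> 0 < t i -> t j < 0 -> s i * t j = s j * t i) ->
  exists2 r, r != 0 & forall k, K k -> s k = r * t k.
Proof.
move=> Ki0 Kj0 si0 sj0.
wlog ti0 : t / 0 < t i0.
  move=> wlog_pos opposite ratio; have [ti0|ti0|ti0] := ltrgt0P (t i0).
  - exact: (wlog_pos t).
  - have [|i j Ki Kj si sj|i j Ki Kj|r r_neq0 rE] := wlog_pos (fun k => - t k).
    + by rewrite oppr_gt0.
    + by rewrite mulrNN opposite.
    + by rewrite oppr_gt0 oppr_lt0 => ti tj; rewrite !mulrN (ratio j i).
    + by exists (- r) => [|k /rE ->]; rewrite ?oppr_eq0 // mulrN mulNr.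
  - by have := opposite i0 j0 Ki0 Kj0 si0 sj0; rewrite ti0 mul0r ltxx.
move=> opposite ratio.
have tj0 : t j0 < 0 by rewrite -(pmulr_rlt0 _ ti0) opposite.
exists (s i0 / t i0) => [|k Kk].
  by rewrite mulf_neq0 ?invr_neq0 // gt_eqF.
have [tk|tk|tk] := ltrgt0P (t k).
- have kE := ratio k j0 Kk Kj0 tk tj0; have i0E := ratio i0 j0 Ki0 Kj0 ti0 tj0.
  rewrite mulrAC; apply: (canRL (mulfK (lt0r_neq0 ti0))).
  by apply: (mulIf (ltr0_neq0 tj0)); rewrite mulrAC kE [RHS]mulrAC i0E mulrAC.
- by have /= kE := ratio i0 k Ki0 Kk ti0 tk; rewrite mulrAC kE mulfK ?gt_eqF.
- rewrite tk mulr0; have [sk|sk|//] := ltrgt0P (s k).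
    by have := opposite k j0 Kk Kj0 sk sj0; rewrite tk mul0r ltxx.
  by have := opposite i0 k Ki0 Kk si0 sk; rewrite tk mulr0 ltxx.
Qed.

Hypothesis ha : is_point_configuration a.

(* In a full-dimensional cell crossing z = 0 but none of whose halves with
   respect to g = 0 crosses it, the two hyperplanes agree. *)
Lemma crosses_hyperplane_add_hyperplane u z g l :
    is_split a (hyperplane_weight a g) (separated_pairs a g) -> 0 < l ->
    ~ (exists2 r, r != 0 & z = r *: g) ->
    gap_additive a [:: u; l *: hyperplane_weight a g] ->
    crosses a (separated_pairs a z) u ->
  crosses a (separated_pairs a z) (u + l *: hyperplane_weight a g).
Proof.
move=> g_split l_gt0 not_collinear additive [x0 [[i0 j0] [ux0]]].
rewrite separated_pairsP => /andP[zi0 zj0] /= xi0 xj0.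
have [x [ux x_vertex] /fintype.subsetP cell_sub] := exists_vertex ha ux0.
have x_keeps k : slack a u x0 k = 0 -> slack a u x k = 0.
  by move=> xk; have := cell_sub k; rewrite !inE xk eqxx => /(_ isT)/eqP.
apply: contrapT => not_crosses.
have opposite i j : slack a u x i = 0 -> slack a u x j = 0 ->
    0 < aff z (a i) -> aff z (a j) < 0 -> aff g (a i) * aff g (a j) < 0.
  move=> xi xj zi zj; rewrite ltNge; apply/negP => same_side.
  have ijD : (i, j) \in separated_pairs a z by rewrite separated_pairsP zi zj.
  apply: not_crosses.
  exact: crosses_add_hyperplane (ltW l_gt0) ijD ux xi xj same_side.
have zero k : slack a u x k = 0 -> aff g (a k) = 0 -> aff z (a k) = 0.
  move=> xk gk; have [zk|zk|//] := ltrgt0P (aff z (a k)).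
    by have := opposite k j0 xk (x_keeps _ xj0) zk zj0; rewrite gk mul0r ltxx.
  by have := opposite i0 k (x_keeps _ xi0) xk zi0 zk; rewrite gk mulr0 ltxx.
have ratio i j : slack a u x i = 0 -> slack a u x j = 0 ->
    0 < aff g (a i) -> aff g (a j) < 0 ->
    aff z (a i) * aff g (a j) = aff z (a j) * aff g (a i).
  move=> xi xj gi gj.
  have ijD : (i, j) \in separated_pairs a g by rewrite separated_pairsP gi gj.
  have direction e : (forall k, aff z (a k) = 0 -> aff e (a k) = 0) ->
      0 <= aff e (a i) / aff g (a i) - aff e (a j) / aff g (a j).
    move=> e0.
    have := split_first_order (z := e) g_split l_gt0 additive ux ijD xi xj.
    rewrite /hyperplane_weight /= gtr0_norm // ltr0_norm // invrN mulrN; apply.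
    by move=> k xk /eqP; rewrite normr_eq0 => /eqP/(zero k xk)/e0 ->.
  apply/eqP; rewrite -eqr_div ?(gt_eqF gi) ?(lt_eqF gj) //.
  rewrite -subr_eq0 eq_le direction // andbT.
  have := direction (- z); rewrite !affN !mulNr -opprD oppr_ge0; apply.
  by move=> k zk; rewrite affN zk oppr0.
have [r r_neq0 rE] := collinear_of_separation
  (x_keeps _ xi0) (x_keeps _ xj0) zi0 zj0 opposite ratio.
apply: not_collinear; exists r => //; apply/eqP; rewrite -subr_eq0; apply/eqP.
by apply: x_vertex => k xk; rewrite affD affN affZ (rE _ xk) subrr.
Qed.

End AddingSplits.

Section SplitDecomposition.
Variables (R : realType) (d : nat) (I : finType) (a : I -> 'rV[R]_d).
Hypothesis ha : is_point_configuration a.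
Variable h : {set {set I}} -> 'rV[R]_d * R.
Hypothesis hh : is_equation_choice a h.
Implicit Types (w : I -> R) (p q : I) (S T : {set {set I}}).

Local Notation J := (I + {set {set I}})%type.
Local Notation hvec S := (equation_vector (h S)).

Lemma two_split_sides S : is_2split a S ->
  is_maximal_pair S (side a (hvec S)) (side a (- hvec S)).
Proof.
move=> S2.
have /induces_2splitP[_ maxE] := hh S2 (exists_two_split_equation S2).
apply/is_maximal_pairP; split=> //; have [_] := S2.
by rewrite maxE cards2; case: eqP.
Qed.

Definition split_weight (j : J) : I -> R :=
  match j with inl p => weight1 R p | inr T => weight2 a (h T) end.

Definition split_pairs (j : J) : {set I * I} :=
  match j with
  | inl p => [set (p, p)]%SET
  | inr T => separated_pairs a (hvec T)
  end.

Definition all_splits : seq J :=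
  [seq inl p | p <- enum (all_1splits a)] ++
  [seq inr T | T <- enum (all_2splits a)].

Lemma all_splits_uniq : uniq all_splits.
Proof.
rewrite cat_uniq !map_inj_uniq ?enum_uniq; try by move=> ? ? [].
by rewrite andbT; apply/hasPn => _ /mapP[S _ ->]; apply/mapP => -[].
Qed.

Lemma mem_all_splits j : (j \in all_splits) =
  match j with inl p => p \in all_1splits a | inr T => T \in all_2splits a end.
Proof.
rewrite mem_cat; apply/orP/idP => [[] /mapP[x + ->]|]; rewrite ?mem_enum //.
by case: j => x x_in; [left|right]; apply/mapP; exists x; rewrite ?mem_enum.
Qed.

Lemma all_splitsP j : (j \in all_splits) <->
  match j with inl p => is_1split_point a p | inr T => is_2split a T end.
Proof.
by rewrite mem_all_splits; case: j => x; rewrite inE; split=> /asboolP.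
Qed.

Lemma all_splits_is_split j :
  j \in all_splits -> is_split a (split_weight j) (split_pairs j).
Proof.
move=> /all_splitsP; case: j => [p|S S2] /=; first exact: point_is_split.
have S_sides := two_split_sides S2.
have [[i zi] [j zj]] := maximal_pair_strict_sides S_sides.
have [_ _ _ _ cover] := S_sides; have [[S_sub _ _] _] := S2.
have z_cover := subdivision_covered_by_sides S_sub cover.
by rewrite weight2E; exact: hyperplane_is_split z_cover zi zj.
Qed.

Lemma all_splits_crosses_add s t u (l : R) :
    s \in all_splits -> t \in all_splits -> s != t -> 0 <= l ->
    gap_additive a [:: u; l *: split_weight t] -> crosses a (split_pairs s) u ->
  crosses a (split_pairs s) (u + l *: split_weight t).
Proof.
move=> sP tP st; rewrite le_eqVlt => /predU1P[<-|l_gt0].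
  by rewrite scale0r addr0.
have t_split := all_splits_is_split tP.
move: sP tP st t_split => /all_splitsP + /all_splitsP.
case: s t => [p|S] [q|T] /= sP tP st t_split additive.
- move=> [x [_ [ux /set1P-> /= xp _]]].
  have qp : p != q by apply: contraNneq st => ->.
  by apply: (crosses_add_point (ltW l_gt0) (set11 (p, p)) ux).
- move=> [x [_ [ux /set1P-> /= xp _]]]; rewrite weight2E.
  apply: (crosses_add_hyperplane (ltW l_gt0) (set11 (p, p)) ux) => //=.
  by rewrite -expr2 sqr_ge0.
- exact: crosses_hyperplane_add_point.
- rewrite weight2E in t_split additive *.
  apply: crosses_hyperplane_add_hyperplane => // -[r r_neq0 zE].
  move/eqP: st; apply; congr inr; apply: (two_split_maximal_faces_inj sP tP).
  have /is_maximal_pairP[_ ->] := two_split_sides sP.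
  have /is_maximal_pairP[_ ->] := two_split_sides tP.
  by rewrite zE sides_scale.
Qed.

Lemma split_primeP w :
  split_prime a w <-> forall j, j \in all_splits -> crosses a (split_pairs j) w.
Proof.
split=> [[prime1 prime2] [p|S] /all_splitsP jP|prime].
- exact/not_coarsens_split1P/prime1.
- exact/(not_coarsens_sidesP _ (two_split_sides jP))/prime2.
split=> [p pP|S SP].
  by apply/not_coarsens_split1P; apply: (prime (inl p)); apply/all_splitsP.
apply/(not_coarsens_sidesP _ (two_split_sides SP)).
by apply: (prime (inr S)); apply/all_splitsP.
Qed.

Definition split_coefficient (l1 : I -> R) (l2 : {set {set I}} -> R) (j : J) :=
  match j with inl p => l1 p | inr T => l2 T end.

Lemma is_split_decompositionP w w0 l1 l2 :
  let l := split_coefficient l1 l2 in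
  is_split_decomposition a h w w0 l1 l2 <->
  [/\ forall j, j \in all_splits -> 0 <= l j,
      forall j, j \in all_splits -> crosses a (split_pairs j) w0
    & is_coherent_decomposition a w
        (w0 :: [seq l j *: split_weight j | j <- all_splits])].
Proof.
move=> l; rewrite /all_splits map_cat -!map_comp -/all_splits.
split=> [[l1_ge0 l2_ge0 /split_primeP w0_crosses coherent]|].
  by split=> // -[x|x]; rewrite mem_all_splits; [exact: l1_ge0|exact: l2_ge0].
move=> [l_ge0 w0_crosses coherent].
split=> // [p pP|S SP|]; last exact/split_primeP.
  by apply: (l_ge0 (inl p)); rewrite mem_all_splits.
by apply: (l_ge0 (inr S)); rewrite mem_all_splits.
Qed.

Lemma exists_split_decomposition w :
  exists w0 l1 l2, is_split_decomposition a h w w0 l1 l2.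
Proof.
have [w0 [l decomposition]] :=
  exists_coherent_decomposition w all_splits_uniq all_splits_is_split.
exists w0, (fun p => l (inl p)), (fun S => l (inr S)).
apply/is_split_decompositionP.
rewrite (_ : split_coefficient _ _ = l); last by apply/funext => -[].
by have [l_ge0 coherent w0_crosses] := decomposition.
Qed.

Lemma split_decomposition_coefficient w w0 l1 l2 j :
    is_split_decomposition a h w w0 l1 l2 -> j \in all_splits ->
  is_coherency_index a (split_weight j) (split_pairs j) w
    (split_coefficient l1 l2 j).
Proof.
move=> /is_split_decompositionP[l_ge0 w0_crosses coherent] jP.
apply: coherent_coefficient jP l_ge0 coherent (w0_crosses j jP).
- exact: all_splits_uniq.
- exact: all_splits_is_split.
- exact: all_splits_crosses_add.
Qed.

Lemma split_decomposition_sum w w0 l1 l2 :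
    is_split_decomposition a h w w0 l1 l2 ->
  w = w0 + \sum_(j <- all_splits) split_coefficient l1 l2 j *: split_weight j.
Proof.
move=> /is_split_decompositionP[_ _ [wE _]].
by apply/funext => i; rewrite wE big_cons big_map fctE fct_sumE.
Qed.

End SplitDecomposition.

Theorem theorem4p6 (R : realType) (d : nat) (I : finType) (a : I -> 'rV[R]_d)
    (ha : is_point_configuration a)
    (h : {set {set I}} -> 'rV[R]_d * R) (hh : is_equation_choice a h)
    (w : I -> R) :
  exists (w0 : I -> R) (l1 : I -> R) (l2 : {set {set I}} -> R),
    is_split_decomposition a h w w0 l1 l2 /\
    forall (w0' : I -> R) (l1' : I -> R) (l2' : {set {set I}} -> R),
      is_split_decomposition a h w w0' l1' l2' ->
      [/\ w0' = w0,
          forall p, p \in all_1splits a -> l1' p = l1 p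
        & forall S, S \in all_2splits a -> l2' S = l2 S].
Proof.
have [w0 [l1 [l2 dec]]] := exists_split_decomposition hh w.
exists w0, l1, l2; split=> // w0' l1' l2' dec'.
have coefE j : j \in all_splits a ->
    split_coefficient l1' l2' j = split_coefficient l1 l2 j.
  move=> j_split; apply: coherency_index_uniq.
  - exact: split_decomposition_coefficient dec' j_split.
  - exact: split_decomposition_coefficient dec j_split.
split.
- apply: (addIr (\sum_(j <- all_splits a)
    split_coefficient l1 l2 j *: split_weight a h j)).
  rewrite -(split_decomposition_sum hh dec) (split_decomposition_sum hh dec').
  by congr (_ + _); apply: eq_big_seq => j /coefE ->.
- by move=> p pP; apply: (coefE (inl p)); rewrite mem_all_splits.
- by move=> S SP; apply: (coefE (inr S)); rewrite mem_all_splits.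
Qed.
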